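(* For every integer $n\ge2$ the set $FS_{n,n}$ satisfies $$\dim_H FS_{n,n}\ \ge\ (n-1)^2+1 .$$ Moreover, the matrices can be chosen of full $\mathbb{R}$-rank $n$, i.e. the same lower bound holds for the set of invertible matrices in $FS_{n,n}$.
   Context: Everything is with respect to the maximum norm $\|\cdot\|_\infty$ on $\mathbb{R}^n$. For $\Omega\in\mathbb{R}^{n\times n}$ and $t\ge1$ let $$\psi_\Omega(t)=\min\{\|\Omega\hat{\boldsymbol b}+\tilde{\boldsymbol b}\|_\infty:\hat{\boldsymbol b},\tilde{\boldsymbol b}\in\mathbb{Z}^n,\ 1\le\|\hat{\boldsymbol b}\|_\infty\le t\},$$ $\Theta(\Omega)=\limsup_{t\to\infty}t\,\psi_\Omega(t)$, $\widetilde\Theta(\Omega)=\liminf_{t\to\infty}t\,\psi_\Omega(t)$, and $D=\sup_{\Omega\in\mathbb{R}^{n\times n}}\Theta(\Omega)$ (which equals $1$). Put $Di_{n,n}=\{\Omega:\Theta(\Omega)<D\}$, $Sing_{n,n}=\{\Omega:\Theta(\Omega)=0\}$, $Bad_{n,n}=\{\Omega:\widetilde\Theta(\Omega)>0\}$, and $FS_{n,n}=Di_{n,n}\setminus(Bad_{n,n}\cup Sing_{n,n})$. $\dim_H$ denotes Hausdorff dimension. *)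

(* Defs.v *)
From HB Require Import structures.
From mathcomp Require Import all_boot all_order all_algebra.
From mathcomp Require Import all_classical all_reals all_analysis.

Set Implicit Arguments.
Unset Strict Implicit.
Unset Printing Implicit Defensive.

Import Order.TTheory GRing.Theory Num.Theory.
Import numFieldNormedType.Exports.

Local Open Scope classical_set_scope.
Local Open Scope ring_scope.

(* The Hausdorff measure and dimension of subsets of a normed space, for the
   distance `|x - y|. *)
Section hausdorff.
Context {R : realType} {V : normedModType R}.
Implicit Types (s d : R) (A U : set V).
Local Open Scope ereal_scope.

(* -oo on the empty set. *)
Definition diam U : \bar R :=
  ereal_sup [set `|x - y|%:E | x in U & y in U].

(* The convention for the empty set is made explicit; diam U `^ 0 = 1 for every
   nonempty U, so that the 0-dimensional measure is the counting measure. *)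
Definition diam_pow s U : \bar R :=
  if U == set0 then 0 else poweR (diam U) s.

Definition hausdorff_premeasure s d A : \bar R :=
  ereal_inf [set \sum_(0 <= i <oo) diam_pow s (U i) |
    U in [set U : (set V)^nat |
           A `<=` \bigcup_i U i /\ forall i, diam (U i) <= d%:E]].

Definition hausdorff_measure s A : \bar R :=
  ereal_sup [set hausdorff_premeasure s d A | d in [set d | (0 < d)%R]].

Definition hausdorff_dim A : \bar R :=
  ereal_inf [set s%:E | s in
    [set s | (0 <= s)%R /\ hausdorff_measure s A = 0]].

End hausdorff.

(* On matrices and column vectors `|_| is the maximum of the absolute values of
   the entries. *)
Section diophantine.
Context {R : realType} {n : nat}.
Implicit Types (Om : 'M[R]_n) (b c : 'cV[int]_n) (t : R).

Definition intv b : 'cV[R]_n := map_mx intr b.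

(* For 0 < n and 1 <= t the infimum is a minimum: see psi_attained below. *)
Definition psi Om t : R :=
  inf [set `|Om *m intv bc.1 + intv bc.2| | bc in
    [set bc : 'cV[int]_n * 'cV[int]_n | 1 <= `|intv bc.1| <= t]].

Definition Theta Om : \bar R :=
  limf_esup (fun t => (t * psi Om t)%:E) (pinfty_nbhs R).

Definition Theta_low Om : \bar R :=
  limf_einf (fun t => (t * psi Om t)%:E) (pinfty_nbhs R).

End diophantine.

Section dirichlet_sets.
Variables (R : realType) (n : nat).
Local Open Scope ereal_scope.

Definition dirichlet_const : \bar R := ereal_sup (range (@Theta R n)).

Definition Di : set 'M[R]_n := [set Om | Theta Om < dirichlet_const].

Definition Sing : set 'M[R]_n := [set Om | Theta Om = 0].

Definition Bad : set 'M[R]_n := [set Om | 0 < Theta_low Om].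

Definition FS : set 'M[R]_n := Di `\` (Bad `|` Sing).

End dirichlet_sets.

Arguments Di : clear implicits.
Arguments Sing : clear implicits.
Arguments Bad : clear implicits.
Arguments FS : clear implicits.

Section psi_attained.
Context {R : realType} {n : nat}.
Implicit Types (Om : 'M[R]_n) (b c : 'cV[int]_n) (t : R).

Let mx_normP m p (x : 'M[R]_(m, p)) e : 0 <= e ->
  reflect (forall i j, `|x i j| <= e) (`|x| <= e).
Proof.
move=> e0; rewrite /Num.norm/= mx_normrE; apply: (iffP (bigmax_leP _ _ _ _)).
  by move=> [_ h] i j; exact: (h (i, j)).
by move=> h; split=> // -[i j] _; exact: h.
Qed.

Let mulmx_bound Om (v : 'cV[R]_n) t : 0 <= t -> `|v| <= t ->
  `|Om *m v| <= (\sum_i \sum_j `|Om i j|) * t.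
Proof.
move=> t0 vt; have /(mx_normP _ t0) vt' := vt.
have S0 i : 0 <= \sum_j `|Om i j| by exact: sumr_ge0.
apply/mx_normP => [|i j]; first by rewrite mulr_ge0 ?sumr_ge0.
rewrite mxE (le_trans (ler_norm_sum _ _ _))//.
rewrite [X in _ <= X * _](bigD1 i)//= mulrDl ler_wpDr ?mulr_ge0 ?sumr_ge0// mulr_suml.
by apply: ler_sum => k _; rewrite normrM ler_wpM2l.
Qed.

Lemma psi_attained Om t : (0 < n)%N -> 1 <= t ->
  exists b c, [/\ 1 <= `|intv b : 'cV[R]_n| <= t,
    psi Om t = `|Om *m intv b + intv c| &
    forall b' c', 1 <= `|intv b' : 'cV[R]_n| <= t ->
      `|Om *m intv b + intv c| <= `|Om *m intv b' + intv c'| ].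
Proof.
move=> n0 t1; have t0 : 0 <= t by rewrite (le_trans ler01).
pose M := (\sum_i \sum_j `|Om i j|) * t.
have M0 : 0 <= M by rewrite mulr_ge0 ?sumr_ge0// => i _; rewrite sumr_ge0.
pose k := Num.bound (t + M + M).
have kM : t + M + M <= k%:R.
  by rewrite ltW// /k archi_boundP// !addr_ge0.
pose box := 'cV['I_(k + k).+1]_n.
pose dec (x : box) : 'cV[int]_n := map_mx (fun i : 'I__ => i%:Z - k%:Z) x.
have decP b : `|intv b : 'cV[R]_n| <= k%:R -> exists x, dec x = b.
  move=> /mx_normP bk; exists (map_mx (fun z => inord `|(z + k%:Z)%R|%N) b).
  apply/matrixP => i j; rewrite !mxE.
  have := bk (ler0n _ _) i j; rewrite mxE -intr_norm -[k%:R]/(k%:~R) ler_int.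
  rewrite ler_norml => /andP[b1 b2].
  have bk0 : 0 <= b i j + k%:Z by rewrite -lerBlDr sub0r.
  rewrite inordK; first by rewrite gez0_abs// addrK.
  by rewrite ltnS -lez_nat gez0_abs// PoszD lerD2r.
pose adm (p : box * box) := 1 <= `|intv (dec p.1) : 'cV[R]_n| <= t.
pose val p := `|Om *m intv (dec p.1) + intv (dec p.2)|.
have n1 : `|intv (const_mx 1) : 'cV[R]_n| = 1.
  apply/eqP; rewrite eq_le; apply/andP; split.
    by apply/mx_normP => // i j; rewrite !mxE normr1.
  have /mx_normP-/(_ (normr_ge0 _) (Ordinal n0) 0) :=
    lexx `|intv (const_mx 1) : 'cV[R]_n|.
  by rewrite !mxE normr1.
have tk : t <= k%:R by rewrite (le_trans _ kM)// -addrA lerDl addr_ge0.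
have [x1 x1E] : exists x, dec x = const_mx 1.
  by apply: decP; rewrite n1 (le_trans t1).
have intv0 : intv 0 = 0 :> 'cV[R]_n by apply/matrixP => i j; rewrite !mxE.
have [x0 x0E] : exists x, dec x = 0.
  by apply: decP; rewrite intv0 normr0.
have adm0 : adm (x1, x0) by rewrite /adm/= x1E n1 lexx.
have val0 : val (x1, x0) <= M.
  by rewrite /val/= x1E x0E intv0 addr0 mulmx_bound// n1.
pose p := [arg min_(p < (x1, x0) | adm p) val p]%O.
have [admp pmin] : adm p /\ forall q, adm q -> val p <= val q.
  by rewrite /p; case: arg_minP.
have H b' c' : 1 <= `|intv b' : 'cV[R]_n| <= t ->
    val p <= `|Om *m intv b' + intv c'|.
  move=> bt; have [b1 b2] := andP bt.
  have [x xE] := decP _ (le_trans b2 tk).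
  have [ck|ck] := leP `|intv c' : 'cV[R]_n| k%:R.
    by have [y yE] := decP _ ck; rewrite -xE -yE; apply: (pmin (x, y));
      rewrite /adm/= xE.
  rewrite (le_trans (pmin _ adm0))// (le_trans val0)//.
  have := ler_normD (Om *m intv b' + intv c') (- (Om *m intv b')).
  rewrite addrAC subrr add0r normrN => h.
  have := mulmx_bound Om t0 b2; rewrite -/M => h'.
  rewrite -(lerD2r M) (le_trans _ (le_trans h (lerD (lexx _) h')))//.
  by rewrite (le_trans _ (ltW ck))// (le_trans _ kM)// -addrA lerDr.
exists (dec p.1), (dec p.2); split => //.
rewrite /psi; set S := [set _ | _ in _].
have Sp : S (val p) by exists (dec p.1, dec p.2).
have lbS : lbound S (val p) by move=> _ [[b' c'] /= bt <-]; exact: H.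
apply/eqP; rewrite eq_le; apply/andP; split.
  by apply: ge_inf => //; exists (val p).
by apply: lb_le_inf => //; exists (val p).
Qed.

End psi_attained.

(* Main.v *)
Require Import Defs.
From mathcomp Require Import all_boot all_order all_algebra.
From mathcomp Require Import all_classical all_reals all_analysis.
From mathcomp Require Import ring lra zify.

(* Consider the matrices Om whose last column is (0, ..., 0, alpha) and whose
   first column is (beta, 0, ..., 0, C), where beta is a fixed irrational number
   with liminf q ||q beta|| = 0 and alpha is badly approximable; the middle
   columns and C are free.  This leaves (n - 1)^2 free entries, and alpha runs
   over sets of dimension arbitrarily close to 1.
   - The last column gives Theta Om <= Theta alpha < 1, whereas
     1 <= Theta (beta I) shows that the Dirichlet constant is at least 1.
   - If q ||q beta|| is small, the pigeonhole principle applied to the numbers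
     u q C + v alpha yields b = (q u, 0, ..., 0, v) showing that the liminf is 0.
   - If p/q is a very good approximation of beta then |b beta + c| >= ||q beta||
     for 0 < |b| <= t = 1/(2 ||q beta||).  So t psi Om t is bounded below unless
     the middle rows, which only involve the middle entries of b, take small
     values.  By a union bound over b this happens on at most half of the middle
     blocks, for every t; hence Theta Om > 0 for a limsup set of middle blocks of
     measure at least 1/2.
   - Adding (n + 1) I does not change psi and makes Om diagonally dominant.
   All entries are read off from the digits of one real number x in [0, 1) in
   base (N - 2) N^((n - 1)^2), so that a set of diameter N^-k pulls back into a
   bounded number of intervals of level k, and Lebesgue measure on [0, 1) plays
   the role of a Frostman measure. *)

Set Implicit Arguments.
Unset Strict Implicit.
Unset Printing Implicit Defensive.

Import Order.TTheory GRing.Theory Num.Theory.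
Import numFieldNormedType.Exports.

Local Open Scope classical_set_scope.
Local Open Scope ring_scope.

(** * Bounds on psi and Theta *)

Lemma mx_norm_leP (R : realType) m p (x : 'M[R]_(m, p)) e : 0 <= e ->
  reflect (forall i j, `|x i j| <= e) (`|x| <= e).
Proof.
move=> e0; rewrite /Num.norm/= mx_normrE; apply: (iffP (bigmax_leP _ _ _ _)).
  by move=> [_ h] i j; exact: (h (i, j)).
by move=> h; split=> // -[i j] _; exact: h.
Qed.

Section psi_bounds.
Context {R : realType} {n : nat}.
Implicit Types (Om : 'M[R]_n) (b c : 'I_n -> int) (t v : R).

Let mulmx_intvE Om (b c : 'cV[int]_n) i :
  (Om *m intv b + intv c) i 0 =
  \sum_j Om i j * (b j 0)%:~R + (c i 0)%:~R.
Proof. by rewrite !mxE; congr (_ + _); apply: eq_bigr => j _; rewrite mxE. Qed.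

(** The infimum is attained, so it inherits a bound valid for every admissible vector. Integer
    vectors are functions here, so that witnesses can be given by cases on the index. *)
Lemma psi_ge Om t v : (0 < n)%N -> 1 <= t ->
  (forall b c, (exists j, b j != 0) -> (forall j, `|(b j)%:~R| <= t) ->
    exists i, v <= `|\sum_j Om i j * (b j)%:~R + (c i)%:~R|) ->
  v <= psi Om t.
Proof.
move=> n0 t1 H; have [b [c [/andP[b1 bt] -> _]]] := psi_attained Om n0 t1.
have t0 : 0 <= t by exact: le_trans t1.
have /mx_norm_leP-/(_ t0) bt' := bt.
have [||i vi] := H (fun j => b j 0) (fun j => c j 0).
- apply: contrapT => bN; suff : `|intv b : 'cV[R]_n| <= 0 by lra.
  apply/mx_norm_leP => // i j; rewrite ord1 mxE.
  have [->|/eqP bi] := eqVneq (b i 0) 0; first by rewrite normr0.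
  by exfalso; apply: bN; exists i; apply/eqP.
- by move=> j; have := bt' j 0; rewrite mxE.
rewrite -mulmx_intvE in vi; apply: (le_trans vi).
by have /mx_norm_leP := lexx `|Om *m intv b + intv c|; apply.
Qed.

Lemma psi_le Om t v b c : 0 <= v -> 0 <= t ->
  (exists j, b j != 0) -> (forall j, `|(b j)%:~R| <= t) ->
  (forall i, `|\sum_j Om i j * (b j)%:~R + (c i)%:~R| <= v) ->
  psi Om t <= v.
Proof.
move=> v0 t0 [j bj] bt H.
pose B : 'cV[int]_n := \col_i b i; pose C : 'cV[int]_n := \col_i c i.
apply: (@le_trans _ _ `|Om *m intv B + intv C|).
  apply: ge_inf; first by exists 0 => _ [bc _ <-].
  exists (B, C) => //=; apply/andP; split; last first.
    by apply/mx_norm_leP => // i k; rewrite !mxE.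
  have /mx_norm_leP-/(_ (normr_ge0 _) j 0) := lexx `|intv B : 'cV[R]_n|.
  apply: le_trans; rewrite !mxE -intr_norm -[1]/(1%:~R) ler_int.
  by rewrite -gtz0_ge1 normr_gt0.
apply/mx_norm_leP => // i k; rewrite ord1 mulmx_intvE; apply: le_trans (H i).
by rewrite mxE; under eq_bigr do rewrite mxE.
Qed.

Lemma Theta_le Om v M : (forall t, M < t -> t * psi Om t <= v) ->
  (Theta Om <= v%:E)%E.
Proof.
move=> H; apply: (@le_trans _ _ (ereal_sup
    [set (t * psi Om t)%:E | t in [set t | M < t]])).
  apply: ereal_inf_lbound; exists [set t | M < t] => //.
  by exists M; split; [exact: num_real|].
by apply: ge_ereal_sup => _ [t /= t1 <-]; rewrite lee_fin H.
Qed.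

Lemma Theta_ge Om v :
  (forall M, exists2 t, M < t & v <= t * psi Om t) -> (v%:E <= Theta Om)%E.
Proof.
move=> H; apply: le_ereal_inf_tmp => _ [V [M [_ MV]] <-].
have [t Mt vt] := H M; apply: (@le_trans _ _ (t * psi Om t)%:E).
  by rewrite lee_fin.
by apply: ereal_sup_ubound; exists t => //; exact: MV.
Qed.

Lemma Theta_low_le Om v :
  (forall M, exists2 t, M < t & t * psi Om t <= v) -> (Theta_low Om <= v%:E)%E.
Proof.
move=> H; rewrite /Theta_low /limf_einf leeNl -EFinN.
apply: le_ereal_inf_tmp => _ [V [M [_ MV]] <-].
have [t Mt vt] := H M; apply: (@le_trans _ _ (- (t * psi Om t)%:E)%E).
  by rewrite -EFinN lee_fin lerN2.
by apply: ereal_sup_ubound; exists t => //; exact: MV.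
Qed.

End psi_bounds.

(** * One-dimensional approximation *)

Section approximation.
Context {R : realType}.
Implicit Types (a b c x y t : R).

(** Cut [0, 1) into [H] boxes: two fractional parts fall in the same box, and [p] is the resulting
    difference of integer parts. *)
Lemma pigeonhole_mod1 (I : finType) (x : I -> R) (H : nat) :
  (0 < H)%N -> (H < #|I|)%N ->
  exists i j (p : int), i != j /\ H%:R * `|x i - x j + p%:~R| < 1.
Proof.
move=> H0 HI; pose fr i := x i - (Num.floor (x i))%:~R.
have fr01 i : 0 <= fr i < 1.
  by have := floor_itv (x i); rewrite intrD1 /fr; lra.
have H0' : (0 : R) < H%:R by rewrite ltr0n.
have trlt i : (Num.truncn (fr i * H%:R) < H)%N.
  have /andP[f0 f1] := fr01 i.
  have f0' : 0 <= fr i * H%:R by rewrite mulr_ge0.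
  have /andP[h1 h2] := truncn_itv f0'.
  by rewrite -(ltr_nat R) (le_lt_trans h1)// -[ltRHS]mul1r ltr_pM2r.
pose box i : 'I_H := Ordinal (trlt i).
have : ~~ injectiveb box.
  apply/negP => /injectiveP /leq_card; rewrite card_ord => h.
  by move: HI; rewrite ltnNge h.
move/injectivePn => [i [j ij /(congr1 val)/= eqij]].
exists i, j, (Num.floor (x j) - Num.floor (x i)); split => //.
have -> : x i - x j + (Num.floor (x j) - Num.floor (x i))%:~R = fr i - fr j.
  by rewrite rmorphB /fr /=; ring.
have /andP[f0 f1] := fr01 i; have /andP[g0 g1] := fr01 j.
have /truncn_itv/andP[h1 h2] : 0 <= fr i * H%:R by rewrite mulr_ge0.
have /truncn_itv/andP[h3 h4] : 0 <= fr j * H%:R by rewrite mulr_ge0.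
rewrite -[X in X * _](gtr0_norm H0') -normrM ltr_norml.
rewrite eqij in h1 h2; rewrite -natr1 in h2; rewrite -natr1 in h4.
by apply/andP; split; nra.
Qed.

Lemma dirichlet1 a (T : nat) : (0 < T)%N ->
  exists q p : int, [/\ 0 < q, q <= T%:Z & T%:R * `|q%:~R * a + p%:~R| < 1].
Proof.
move=> T0; have := @pigeonhole_mod1 'I_T.+1 (fun i => i%:R * a) T T0.
rewrite card_ord => /(_ (ltnSn _)) [i [j [p [ij]]]].
wlog ji : i j p ij / (j < i)%N => [W|].
  have [|ij'] := ltnP j i; first exact: W.
  have ji : j != i by rewrite eq_sym.
  have lt_ij : (i < j)%N by rewrite ltn_neqAle ij' andbT.
  move=> h; apply: (W j i (- p) ji lt_ij).
  suff -> : j%:R * a - i%:R * a + (- p)%:~R = - (i%:R * a - j%:R * a + p%:~R).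
    by rewrite normrN.
  by rewrite rmorphN/=; ring.
move=> h; exists (i%:Z - j%:Z), p; split; first by rewrite subr_gt0 ltz_nat.
  by have := ltn_ord i; lia.
by rewrite rmorphB/= mulrBl.
Qed.

Definition badly_approx c a :=
  forall q p : int, q != 0 -> c <= `|q%:~R| * `|q%:~R * a + p%:~R|.

(** Lower bound: [Q' * e] exceeds [1 - k] and [Q * e'] is at least [c^2 / 4 = 4 k]. Upper bound: [Q]
    stays below [Q'] by at least [c / 2 * t], which outweighs all the terms in [k]. *)
Let opposite_errors c k t Q Q' e e' :
  0 < c <= 2^-1 -> 0 < k <= c / 32 -> c * c = 16 * k -> 0 < t ->
  0 <= e -> 0 <= e' -> 1 - k < t * e -> t * e <= 1 + k -> t * e' < 1 - k ->
  t < Q' -> Q' <= t * (1 + 3 * k) ->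
  c / 2 * t <= Q -> c / 2 <= t * e' -> c <= (Q' - Q) * (e + e') ->
  1 < Q' * e + Q * e' < 2.
Proof.
move=> /andP[c0 c1] /andP[k0 kc] cck t0 e0 e'0 A1 A2 A3 A4 A5 B1 B2 B3.
have B4 : c / 2 * t <= Q' - Q.
  have : c * t <= (Q' - Q) * 2.
    apply: (@le_trans _ _ ((Q' - Q) * (t * e + t * e'))).
      by rewrite -mulrDr mulrCA mulrC ler_pM2l.
    rewrite ler_wpM2l//; last by lra.
    have : 0 < e + e' by rewrite ltr_wpDr//; nra.
    by move=> ee; rewrite -(pmulr_lge0 _ ee); lra.
  by lra.
have B5 : Q <= t * (1 + 3 * k - c / 2) by lra.
have C1 : t * (1 - k) < Q' * (t * e) by apply: ltr_pM => //; lra.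
have C2 : c / 2 * t * (c / 2) <= Q * (t * e').
  by apply: ler_pM => //; [rewrite !mulr_ge0// ltW|lra].
have C3 : Q' * (t * e) <= t * (1 + 3 * k) * (1 + k).
  by apply: ler_pM => //; [lra|rewrite mulr_ge0// ltW].
have C4 : Q * (t * e') <= t * (1 + 3 * k - c / 2) * (1 - k).
  apply: ler_pM => //; last exact: ltW.
    by apply: le_trans B1; rewrite !mulr_ge0// ltW.
  by rewrite mulr_ge0// ltW.
have C5 : c / 2 * t * (c / 2) = 4 * (t * k).
  by transitivity (c * c * t / 4); [field|rewrite cck; field].
have tk : 0 < t * k by rewrite mulr_gt0.
have E : t * (Q' * e + Q * e') = Q' * (t * e) + Q * (t * e') by ring.
apply/andP; split; rewrite -(ltr_pM2l t0) E; first by lra.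
have : t * ((1 + 3 * k) * (1 + k) + (1 + 3 * k - c / 2) * (1 - k)) < t * 2.
  by rewrite ltr_pM2l//; nra.
by lra.
Qed.

(** Both [t * e] and [t * e'] lie in [[c / 2, 1 + k]], an interval of length at most [1 - k] because
    [16 k <= c / 2]. *)
Let same_errors c k t Q Q' e e' :
  0 < k <= c / 32 -> 0 < t ->
  1 - k < t * e -> t * e <= 1 + k -> t * e' < 1 - k ->
  Q' <= t * (1 + 3 * k) -> c / 2 * t <= Q -> c / 2 <= t * e' ->
  Q' - Q <= t /\ t * `|e' - e| <= 1 - k.
Proof.
move=> /andP[k0 kc] t0 A1 A2 A3 A5 B1 B2; split.
  have : t * (3 * k) <= t * (c / 2) by rewrite ler_pM2l//; lra.
  by lra.
by rewrite -[X in X * _](gtr0_norm t0) -normrM ler_norml mulrBr; lra.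
Qed.

Let sign_cases x x' Q Q' : 0 <= Q -> 0 <= Q' ->
  `|x' - x| = `| `|x'| - `|x| | \/
  `|x' - x| = `|x| + `|x'| /\ `|Q' * x - Q * x'| = Q' * `|x| + Q * `|x'|.
Proof.
move=> Q0 Q'0; have [x0|/ltW x0] := leP 0 x; have [x'0|/ltW x'0] := leP 0 x'.
- by left; rewrite (ger0_norm x0) (ger0_norm x'0).
- right; rewrite (ger0_norm x0) (ler0_norm x'0) ler0_norm; last by lra.
  rewrite ger0_norm; first by split; ring.
  by rewrite subr_ge0 (@le_trans _ _ 0)// ?mulr_ge0// mulr_ge0_le0.
- right; rewrite (ler0_norm x0) (ger0_norm x'0) ger0_norm; last by lra.
  rewrite ler0_norm; first by split; ring.
  by rewrite subr_le0 (@le_trans _ _ 0)// ?mulr_ge0// mulr_ge0_le0.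
- by left; rewrite (ler0_norm x0) (ler0_norm x'0) -opprD normrN.
Qed.

Let no_int_12 (z : int) : 1 < z < 2 -> False.
Proof. lia. Qed.

(* The pairs (q, p) and (q', p') are two successive good approximations;
   q' p - q p' is an integer, strictly between 1 and 2 in absolute value when
   the two errors have opposite signs, while (q' - q, p' - p) is a good
   approximation when they have the same sign. *)
Lemma badly_approx_dirichlet c a t : 0 < c <= 2^-1 -> badly_approx c a ->
  16 / c ^+ 2 + 1 < t ->
  exists q p : int, [/\ q != 0, `|q%:~R| <= t &
    t * `|q%:~R * a + p%:~R| <= 1 - c ^+ 2 / 16].
Proof.
move=> c01 ba tc; apply: contrapT => none; have /andP[c0 c1] := c01.
(* Suppose that no pair gains [k]. The hypothesis on [t] reads [k^-1 + 1 < t], so that replacing [t]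
   by its integer part costs a factor at most [1 + k]. *)
set k := c ^+ 2 / 16 in none *.
have k0 : 0 < k by rewrite /k divr_gt0 ?exprn_gt0.
have kc : k <= c / 32 by rewrite /k expr2; nra.
have t1 : k^-1 + 1 < t by rewrite /k invf_div.
have k0c : 0 < k <= c / 32 by rewrite k0.
have cck : c * c = 16 * k by rewrite /k expr2; field.
have {tc} kt : 1 + k < k * t.
  by have := t1; rewrite -(ltr_pM2l k0) mulrDr mulfV ?gt_eqF// mulr1.
have t0 : 0 < t by apply: lt_trans t1; rewrite addr_gt0 ?invr_gt0.
have big (q p : int) : q != 0 -> `|q%:~R : R| <= t ->
    1 - k < t * `|q%:~R * a + p%:~R|.
  by move=> q0 qt; rewrite ltNge; apply/negP => h; apply: none; exists q, p.
have /truncn_itv/andP[T1 T2] := ltW t0.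
set T := Num.truncn t in T1 T2; rewrite -natr1 in T2.
have T0 : (0 < T)%N.
  by rewrite -(ltr_nat R); have := k0; nra.
have [q [p [q0 qT qp]]] := dirichlet1 a T0.
(* The second pair comes from the larger scale [t / (1 - k)]: its error is below [(1 - k) / t], so
   by assumption its denominator exceeds [t]. *)
have t0' : 0 <= t / (1 - k) by apply: divr_ge0; lra.
have /truncn_itv/andP[U1 U2] := t0'.
set U := Num.truncn _ in U1 U2.
have [q' [p' [q'0 q'U qp']]] := dirichlet1 a (ltn0Sn U).
have qR : 0 < (q%:~R : R) by rewrite ltr0z.
have q'R : 0 < (q'%:~R : R) by rewrite ltr0z.
have e1 := ba q p (lt0r_neq0 q0); have e2 := ba q' p' (lt0r_neq0 q'0).
rewrite gtr0_norm// in e1; rewrite gtr0_norm// in e2.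
set x := q%:~R * a + p%:~R in qp e1.
set x' := q'%:~R * a + p'%:~R in qp' e2.
have qt : (q%:~R : R) <= t.
  by apply: le_trans T1; rewrite -[T%:R]/((T%:Z)%:~R) ler_int.
have A1 : 1 - k < t * `|x| by apply: big; rewrite ?lt0r_neq0 ?gtr0_norm.
have A2 : t * `|x| <= 1 + k.
  have x0 := normr_ge0 x; have kT : 1 <= k * T%:R by nra.
  have : `|x| <= k * T%:R * `|x| by rewrite ler_peMl.
  by rewrite -mulrA => h; nra.
have A3 : t * `|x'| < 1 - k.
  have x0 := normr_ge0 x'.
  have : t < U.+1%:R * (1 - k) by rewrite -ltr_pdivrMr//; lra.
  by nra.
have A4 : t < q'%:~R.
  rewrite ltNge; apply/negP => h.
  have := big q' p' (lt0r_neq0 q'0); rewrite gtr0_norm// => /(_ h).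
  by rewrite -/x'; lra.
have A5 : (q'%:~R : R) <= t * (1 + 3 * k).
  have : (q'%:~R : R) <= U%:R + 1.
    by rewrite natr1 -[U.+1%:R]/((U.+1%:Z)%:~R) ler_int.
  have : t / (1 - k) <= t * (1 + 2 * k).
    by rewrite ler_pM2l// -[leLHS]mul1r ler_pdivrMr; nra.
  by nra.
set Q := (q%:~R : R) in qR e1 qt; set Q' := (q'%:~R : R) in q'R e2 A4 A5.
have x0 := normr_ge0 x; have x'0 := normr_ge0 x'.
set e := `|x| in A1 A2 e1 x0 qp; set e' := `|x'| in A3 e2 x'0 qp'.
have B1 : c / 2 * t <= Q by nra.
have B2 : c / 2 <= t * e' by nra.
have qq' : q < q' by rewrite -(ltr_int R); exact: le_lt_trans A4.
have dq : q' - q != 0 by rewrite subr_eq0 gt_eqF.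
have dQ : `|(q' - q)%:~R : R| = Q' - Q.
  by rewrite rmorphB/= gtr0_norm// subr_gt0; exact: le_lt_trans A4.
have dx : (q' - q)%:~R * a + (p' - p)%:~R = x' - x.
  by rewrite /x /x' !rmorphB/=; ring.
have := ba (q' - q) (p' - p) dq; rewrite dQ dx => B3.
have [xx|[xx D]] := sign_cases x x' (ltW qR) (ltW q'R).
  have [h1 h2] := same_errors k0c t0 A1 A2 A3 A5 B1 B2.
  have := big (q' - q) (p' - p) dq; rewrite dQ dx xx => /(_ h1).
  by rewrite ltNge h2.
rewrite xx in B3.
apply: (@no_int_12 `|q' * p - q * p'|).
rewrite -!(ltr_int R) intr_norm.
have -> : (q' * p - q * p')%:~R = Q' * x - Q * x'.
  by rewrite rmorphB !rmorphM /= /x /x' -/Q -/Q'; ring.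
by rewrite D (opposite_errors c01 k0c cck t0 x0 x'0 A1 A2 A3 A4 A5 B1 B2 B3).
Qed.

End approximation.

(** * Matrices with sparse first and last columns *)

(** Look at a coordinate where a kernel vector has largest absolute value. Transposing lets the row
    vectors of [kermx] meet the rows of [A]. *)
Lemma diag_dominant_unitmx (R : realFieldType) n (A : 'M[R]_n) :
  (forall i, \sum_(j | j != i) `|A i j| < `|A i i|) -> A \in unitmx.
Proof.
move=> dom; rewrite -unitmx_tr -row_free_unit -kermx_eq0.
apply/rowV0P => v /sub_kermxP vA; apply/rowP => k; rewrite [RHS]mxE.
have [i _ imax] := @arg_maxP _ R 'I_n k xpredT (fun j => `|v 0 j|) isT.
suff : `|v 0 i| <= 0.
  move=> vi; apply/eqP; rewrite -normr_le0; apply: le_trans vi; exact: imax.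
rewrite leNgt; apply/negP => vi0.
have := congr1 (fun B : 'rV_n => B 0 i) vA; rewrite !mxE (bigD1 i)//= mxE.
move/eqP; rewrite addrC addr_eq0 => /eqP/(congr1 Num.norm).
rewrite normrN normrM => E.
have := dom i; rewrite -(ltr_pM2l vi0) -E ltNge => /negP; apply.
apply: le_trans (ler_norm_sum _ _ _) _; rewrite mulr_sumr.
by apply: ler_sum => j _; rewrite mxE normrM ler_wpM2r//; exact: imax.
Qed.

Section well_approximable.
Context {R : realType}.
Implicit Types (b c : R).

(** The positive error confines this to irrational numbers; coprimality serves [well_approx_gap]. *)
Definition well_approx b := forall e : R, 0 < e ->
  exists q p : int, [/\ q != 0, coprimez q p, 0 < `|q%:~R * b + p%:~R| &
    `|q%:~R| * `|q%:~R * b + p%:~R| <= e].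

Lemma intr_norm_ge1 (z : int) : z != 0 -> 1 <= `|z%:~R : R|.
Proof.
by move=> z0; rewrite -intr_norm -[1]/(1%:~R) ler_int -gtz0_ge1 normr_gt0.
Qed.

(* If u p + v q != 0 then |u b + v| is about 1/q; otherwise (u, v) is a
   multiple of (q, p). *)
Lemma well_approx_gap b (q p u v : int) k : q != 0 -> coprimez q p ->
  `|q%:~R| * `|q%:~R * b + p%:~R| <= k ->
  u != 0 -> `|u%:~R| * `|q%:~R * b + p%:~R| <= 1 - k ->
  `|q%:~R * b + p%:~R| <= `|u%:~R * b + v%:~R|.
Proof.
move=> q0 qp qk u0 uk; set x := q%:~R * b + p%:~R in qk uk *.
have [z0|z0] := eqVneq (q * v - u * p) 0.
  move/eqP: z0; rewrite subr_eq0 => /eqP qv.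
  have : (q %| u)%Z by rewrite -(Gauss_dvdzl _ qp) -qv dvdz_mulr.
  move=> /dvdzP[w uw]; have w0 : w != 0.
    by apply: contra_neq u0 => w0; rewrite uw w0 mul0r.
  have vw : v = w * p.
    by apply: (mulfI q0); rewrite qv uw; ring.
  have -> : u%:~R * b + v%:~R = w%:~R * x.
    by rewrite uw vw !rmorphM/= /x; ring.
  by rewrite normrM ler_peMl// intr_norm_ge1.
have Q0 : 0 < `|q%:~R : R| by rewrite (lt_le_trans ltr01)// intr_norm_ge1.
rewrite -(ler_pM2l Q0) (le_trans qk)// -normrM.
have -> : q%:~R * (u%:~R * b + v%:~R) = (q * v - u * p)%:~R + u%:~R * x.
  by rewrite rmorphB !rmorphM/= /x; ring.
have := lerB_normD ((q * v - u * p)%:~R : R) (u%:~R * x).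
rewrite normrM; have := intr_norm_ge1 z0; lra.
Qed.

End well_approximable.

Section diophantine_structure.
Context {R : realType} {m : nat}.
Implicit Types (Om : 'M[R]_m.+2) (c v : R).

Let omax : 'I_m.+2 := ord_max.

(** Each row involves a single entry of the integer vector. By [well_approx_gap] no denominator up
    to [t = (1 - e) / x] has an error below [x], whence [t * psi >= 1 - e]. *)
Lemma Theta_scalar_ge1 (b : R) : well_approx b ->
  (1%:E <= Theta (b%:M : 'M[R]_m.+2))%E.
Proof.
move=> wb; apply/lee_subgt0Pr => k k0; rewrite -EFinB.
(* The first term gives [1 - k <= 1 - e]; the other two give [t >= |M| + 1]. *)
apply: Theta_ge => M; pose e := Num.min (k / 2) (Num.min (2^-1) ((2 * `|M| + 2)^-1)).
have M0 := normr_ge0 M; have MM := ler_norm M.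
have e0 : 0 < e.
  rewrite !lt_min; apply/and3P; split; first lra; first lra.
  by rewrite invr_gt0; lra.
have ek : e <= k / 2 by rewrite ge_min lexx.
have e1 : e <= 2^-1 by rewrite !ge_min lexx orbT.
have eM : e <= (2 * `|M| + 2)^-1 by rewrite !ge_min lexx !orbT.
have [q [p [q0 qp x0 qx]]] := wb _ e0.
set x := `|_| in x0 qx.
have xe : x <= e by apply: le_trans qx; rewrite ler_peMl ?intr_norm_ge1 ?(ltW x0).
pose t := (1 - e) / x.
have xt : t * x = 1 - e by rewrite /t divfK// gt_eqF.
have t2 : 2^-1 * (2 * `|M| + 2) <= t.
  rewrite /t; apply: ler_pM; [lra|lra|lra|].
  by rewrite -[leRHS]div1r ler_pdivlMr// mulrC -ler_pdivlMr ?div1r; lra.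
exists t; first by lra.
have t0 : 0 < t by lra.
apply: (@le_trans _ _ (t * x)); first by lra.
rewrite ler_pM2l//; apply: psi_ge => //; first by lra.
move=> u v [j uj] ut; exists j; rewrite (bigD1 j)//= big1 => [|i ij]; last first.
  by rewrite mxE eq_sym (negPf ij) mul0r.
rewrite mxE eqxx mulr1n addr0 [b * _]mulrC.
apply: (well_approx_gap _ q0 qp qx uj).
by rewrite -/x -xt ler_wpM2r// ltW.
Qed.

(** Integer vectors supported on the last coordinate see only the corner entry, so the
    one-dimensional improvement of Dirichlet's theorem applies. *)
Lemma last_column_Theta_le Om c : 0 < c <= 2^-1 ->
  (forall i, i != omax -> Om i omax = 0) -> badly_approx c (Om omax omax) ->
  (Theta Om <= (1 - c ^+ 2 / 16)%:E)%E.
Proof.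
move=> c01 O0 ba; apply: (@Theta_le _ _ _ _ (16 / c ^+ 2 + 1)) => t tc.
have [q [p [q0 qt qp]]] := badly_approx_dirichlet c01 ba tc.
have t0 : 0 < t.
  apply: lt_trans tc; rewrite ltr_wpDl//; apply: divr_ge0 => //.
  by rewrite exprn_ge0//; lra.
rewrite mulrC -ler_pdivlMr//.
have h i : `|\sum_j Om i j * ((if j == omax then q else 0)%:~R) +
    ((if i == omax then p else 0)%:~R)| <= (1 - c ^+ 2 / 16) / t.
  rewrite (bigD1 omax)//= eqxx big1 => [|j /negPf->]; last by rewrite mulr0.
  rewrite addr0; have [->|/O0->] := eqVneq i omax.
    by rewrite ler_pdivlMr// mulrC [_ * q%:~R]mulrC.
  rewrite mul0r addr0 normr0; apply: le_trans (normr_ge0 _) _.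
  by rewrite ler_pdivlMr// mulrC; exact: qp.
apply: (psi_le _ (ltW t0) _ _ h).
- by apply: le_trans (normr_ge0 _) (h omax).
- by exists omax; rewrite eqxx.
- by move=> j; case: ifP => // _; rewrite normr0 ltW.
Qed.

Let ord_dist k (i j : 'I_k.+1) : `|i%:Z - j%:Z| <= k%:Z.
Proof. by have := ltn_ord i; have := ltn_ord j; lia. Qed.

(** Take [t = Q T] with [Q = |q|], [|u| <= T] and [|v| <= Q T]. Row 0 contributes at most
    [t T x = Q x T^2 <= e]; the pigeonhole principle with [T * (Q T)] boxes makes the last row
    contribute at most [1 / T]. *)
Lemma corner_Theta_low_le0 Om : (forall i, i != omax -> Om i omax = 0) ->
  (forall i, i != 0 -> i != omax -> Om i 0 = 0) -> well_approx (Om 0 0) ->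
  (Theta_low Om <= 0)%E.
Proof.
move=> O0 O1 wb; apply/lee_addgt0Pr => e e0; rewrite add0e.
apply: Theta_low_le => M.
have M0 := normr_ge0 M; have MM := ler_norm M.
have ei : 0 < e^-1 by rewrite invr_gt0.
(* This [T] ensures both [1 / T <= e] and [Q T > M]. *)
pose T := (Num.truncn (`|M| + e^-1)).+1.
have TM : `|M| + e^-1 < T%:R by exact: truncnS_gt.
have T0 : 0 < (T%:R : R) by lra.
have eT : 1 <= e * T%:R.
  by rewrite -(@ler_pM2l _ e^-1)// mulrA mulVf ?gt_eqF// mul1r mulr1; lra.
have T1 : 1 <= (T%:R : R) by rewrite ler1n.
have [q [p [q0 _ x0 qx]]] := wb (e / T%:R ^+ 2)
  (divr_gt0 e0 (exprn_gt0 _ T0)).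
set x := `|_| in x0 qx.
pose Q := `|q|%N.
have QE : (Q%:R : R) = `|q%:~R| by rewrite /Q natr_absz intr_norm.
have Q1 : 1 <= (Q%:R : R) by rewrite QE intr_norm_ge1.
have Q0 : (0 < Q)%N by rewrite absz_gt0.
pose X (ij : 'I_T.+1 * 'I_(Q * T).+1) :=
  ij.1%:R * q%:~R * Om omax 0 + ij.2%:R * Om omax omax.
have := @pigeonhole_mod1 R _ X (T * (Q * T)).
rewrite !muln_gt0 Q0 /= card_prod !card_ord => /(_ isT).
have -> : (T * (Q * T) < T.+1 * (Q * T).+1)%N by rewrite ltn_mul.
move=> /(_ isT) [[i j] [[i' j'] [p' [ij]]]]; rewrite /X/= => Hp.
pose u : int := i%:Z - i'%:Z; pose v : int := j%:Z - j'%:Z.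
have uT : `|u%:~R| <= (T%:R : R).
  rewrite -intr_norm -[T%:R]/((T%:Z)%:~R) ler_int /u.
  exact: ord_dist.
have vT : `|v%:~R| <= (Q%:R * T%:R : R).
  rewrite -intr_norm -natrM -[(Q * T)%:R]/((Q * T)%:Z%:~R) ler_int.
  exact: ord_dist.
have uv : (u != 0) || (v != 0).
  apply: contra_neqT ij; rewrite negb_or !negbK !subr_eq0 => /andP[/eqP[a1] /eqP[a2]].
  by congr pair; exact: val_inj.
have t0 : 0 < (Q%:R * T%:R : R) by nra.
exists (Q%:R * T%:R); first by nra.
rewrite mulrC -ler_pdivlMr//.
have z0 : (0 : 'I_m.+2) != omax by [].
apply: (psi_le (b := fun k => if k == 0 then q * u else if k == omax then v else 0)
   (c := fun k => if k == 0 then p * u else if k == omax then p' else 0)).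
- by rewrite divr_ge0 ?ltW.
- exact: ltW.
- case/orP: uv => [u0|v0]; first by exists 0; rewrite eqxx mulf_neq0.
  by exists omax; rewrite [omax == 0]eq_sym (negPf z0) eqxx.
- move=> k; case: ifP => _; last first.
    by case: ifP => // _; rewrite normr0 ltW.
  by rewrite rmorphM normrM -QE ler_wpM2l.
move=> k; rewrite (bigD1 0)//= (bigD1 omax)//=.
rewrite big1 => [|l /andP[/negPf-> /negPf->]]; last by rewrite mulr0.
rewrite addr0 ?eqxx/= ler_pdivlMr//.
have [->|k0] := eqVneq k 0.
  rewrite O0// mul0r addr0.
  have -> : Om 0 0 * (q * u)%:~R + (p * u)%:~R = u%:~R * (q%:~R * Om 0 0 + p%:~R).
    by rewrite !rmorphM/=; ring.
  rewrite normrM -/x.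
  apply: (@le_trans _ _ (T%:R * x * (Q%:R * T%:R))).
    by rewrite ler_wpM2r ?(ltW t0)// ler_wpM2r// ltW.
  rewrite (_ : _ * _ = (`|q%:~R| * x) * T%:R ^+ 2); last by rewrite QE; ring.
  by rewrite -ler_pdivlMr// exprn_gt0.
have [->|kmax] := eqVneq k omax; last first.
  by rewrite O0// O1// !mul0r !addr0 normr0 mul0r ltW.
rewrite (_ : _ + p'%:~R = i%:R * q%:~R * Om omax 0 + j%:R * Om omax omax -
      (i'%:R * q%:~R * Om omax 0 + j'%:R * Om omax omax) + p'%:~R); last first.
  by rewrite rmorphM !rmorphB/=; ring.
rewrite -(@ler_pM2l _ T%:R)// [leRHS]mulrC; apply: le_trans eT.
by apply: le_trans (ltW Hp); rewrite !natrM; nra.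
Qed.

(** At [t = 1 / (2 x)] there are three kinds of [b]. A nonzero middle entry is left to the last
    hypothesis; otherwise [b 0 != 0] is handled in row 0 by [well_approx_gap] with [k = 1/2], and a
    lone last entry in the last row by bad approximability. *)
Lemma corner_Theta_ge Om c v : (forall i, i != omax -> Om i omax = 0) ->
  (forall i, i != 0 -> i != omax -> Om i 0 = 0) ->
  badly_approx c (Om omax omax) -> v <= c -> 0 <= v <= 2^-1 ->
  (forall M : R, exists q p : int, let x := `|q%:~R * Om 0 0 + p%:~R| in
    [/\ q != 0, coprimez q p, 0 < x, `|q%:~R| * x <= 2^-1 & M < (2 * x)^-1 /\
      forall b d : 'I_m.+2 -> int,
      (exists j, [/\ j != 0, j != omax & b j != 0]) ->
      (forall j, `|(b j)%:~R| <= (2 * x)^-1) ->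
      exists i, v <= (2 * x)^-1 * `|\sum_j Om i j * (b j)%:~R + (d i)%:~R|]) ->
  (v%:E <= Theta Om)%E.
Proof.
move=> O0 O1 ba vc /andP[v0 v2] H; apply: Theta_ge => M.
have [q [p [q0 qp x0 qx [Mt mid]]]] := H (Num.max M 1).
set x := `|_| in x0 qx Mt mid; set t := (2 * x)^-1 in Mt mid.
move: Mt; rewrite gt_max => /andP[Mt t1]; exists t => //.
have t0 : 0 < t by lra.
have tx : t * x = 2^-1 by rewrite /t invfM divfK// gt_eqF.
rewrite mulrC -ler_pdivrMr//; apply: psi_ge => //; first exact: ltW.
move=> b d bN bt.
have [bmid|bmid] := pselect (exists j, [/\ j != 0, j != omax & b j != 0]).
  have [i vi] := mid b d bmid bt; exists i.
  by rewrite ler_pdivrMr// mulrC.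
have b0 j : j != 0 -> j != omax -> b j = 0.
  move=> j0 jm; apply/eqP; apply: contrapT => /negP bj.
  by apply: bmid; exists j.
have z0 : (0 : 'I_m.+2) != omax by [].
have sumE i : \sum_j Om i j * (b j)%:~R =
    Om i 0 * (b 0)%:~R + Om i omax * (b omax)%:~R.
  rewrite (bigD1 0)//= (bigD1 omax)//=.
  by rewrite big1 ?addr0// => l /andP[l0 lm]; rewrite b0// mulr0.
have [b00|b00] := eqVneq (b 0) 0; last first.
  exists 0; rewrite sumE O0// mul0r addr0 [Om 0 0 * _]mulrC.
  apply: (@le_trans _ _ x); last first.
    apply: (well_approx_gap _ q0 qp qx b00); rewrite -/x.
    apply: (@le_trans _ _ (t * x)); first by rewrite ler_wpM2r// ltW.
    by rewrite tx; lra.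
  by rewrite ler_pdivrMr// mulrC tx.
have bm : b omax != 0.
  case: bN => j bj; have [jm|jm] := eqVneq j omax; first by rewrite -jm.
  by have [j0|j0] := eqVneq j 0; [rewrite j0 b00 in bj|rewrite b0 in bj].
exists omax; rewrite sumE b00 mulr0 add0r [_ * (b omax)%:~R]mulrC.
rewrite ler_pdivrMr// [leRHS]mulrC (le_trans vc)// (le_trans (ba _ (d omax) bm))//.
by rewrite ler_wpM2r.
Qed.

End diophantine_structure.

(** * Radix expansions and a well approximable number *)

Section expansions.
Context {R : realType}.

Lemma nested_intervals (u v : nat -> R) :
  (forall k, u k <= u k.+1) -> (forall k, v k.+1 <= v k) ->
  (forall k, u k <= v k) -> forall k, u k <= sup (range u) <= v k.
Proof.
move=> uS vS uv k.
have /nondecreasing_seqP uM := uS; have /nonincreasing_seqP vM := vS.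
have ub i : ubound (range u) (v i).
  move=> _ [j _ <-]; have [ij|/ltnW ji] := leqP i j.
    exact: le_trans (uv j) (vM _ _ ij).
  exact: le_trans (uM _ _ ji) (uv i).
apply/andP; split; last by apply: ge_sup => //; exists (u 0), 0.
by apply: ub_le_sup; [exists (v 0); exact: ub|exists k].
Qed.

(** Here [z k] is the integer formed by the first [k] digits. Using prefixes allows a digit to
    depend on the preceding ones, as in [skip_radix]. *)
Definition radix_real (N : nat) (z : nat -> nat) : R :=
  sup (range (fun k => (z k)%:R / N%:R ^+ k)).

Lemma radix_real_bounds N z k : (0 < N)%N ->
  (forall k, N * z k <= z k.+1 < N * (z k).+1)%N ->
  (z k)%:R / N%:R ^+ k <= radix_real N z <= (z k)%:R / N%:R ^+ k + (N%:R ^+ k)^-1.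
Proof.
move=> N0 H; have NR : 0 < (N%:R : R) by rewrite ltr0n.
apply: (nested_intervals (u := fun k => (z k)%:R / N%:R ^+ k)
  (v := fun k => (z k)%:R / N%:R ^+ k + (N%:R ^+ k)^-1)) => {}k.
- have /andP[h _] := H k.
  rewrite exprS invfM mulrA ler_wpM2r ?invr_ge0 ?exprn_ge0 ?ler0n//.
  by rewrite ler_pdivlMr// mulrC -natrM ler_nat.
- have /andP[_ h] := H k.
  have E j : (z j)%:R / N%:R ^+ j + (N%:R ^+ j)^-1 = (z j).+1%:R / N%:R ^+ j :> R.
    by rewrite -natr1 mulrDl mul1r.
  rewrite !E exprS invfM mulrA ler_wpM2r ?invr_ge0 ?exprn_ge0 ?ler0n//.
  by rewrite ler_pdivrMr// mulrC -natrM ler_nat.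
- by rewrite lerDl invr_ge0 exprn_ge0// ltW.
Qed.

End expansions.

Section existence_well_approx.
Context {R : realType}.

(** The fractions [lacunary_num k / lacunary_den k] are the partial sums of the series with terms
    [2^(-3^j)]. *)
Fixpoint lacunary_den k : nat :=
  if k is k'.+1 then (lacunary_den k' ^ 3)%N else 2%N.

Fixpoint lacunary_num k : nat :=
  if k is k'.+1 then (lacunary_num k' * lacunary_den k' ^ 2 + 1)%N else 1%N.

Let qs := lacunary_den.
Let ps := lacunary_num.

Let qs_gt k : (k.+1 < qs k)%N.
Proof.
elim: k => //= k IH; rewrite /qs /= -/qs.
by apply: leq_trans (_ : qs k ^ 2 <= _)%N; [nia|rewrite leq_exp2l//; lia].
Qed.

Let qs_coprime k : coprime (qs k) (ps k).
Proof.
case: k => // k; rewrite /ps /= -/(qs k) coprimeXl//.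
by rewrite /coprime -mulnn mulnA gcdnMDl gcdn1.
Qed.

(** The tail after the partial sum with denominator [q] is positive and at most [2 / q^3], so that
    [q |q b - p| <= 2 / q]. *)
Lemma exists_well_approx : exists2 b : R, well_approx b & 0 <= b <= 1.
Proof.
pose u k : R := (ps k)%:R / (qs k)%:R.
pose v k : R := u k + 2 / (qs k)%:R ^+ 3.
have q2 k : 2 <= ((qs k)%:R : R).
  by rewrite ler_nat; have := qs_gt k; lia.
have q0 k : 0 < ((qs k)%:R : R) by apply: lt_le_trans (q2 k).
have uS k : u k.+1 = u k + (qs k)%:R ^- 3.
  rewrite /u /ps /= -/(qs k) natrD natrM !natrX.
  by field; rewrite gt_eqF.
have q3 k : 0 < (qs k)%:R ^- 3 :> R by rewrite invr_gt0 exprn_gt0.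
have bnd : forall k, u k <= sup (range u) <= v k.
  apply: nested_intervals => k.
  - by rewrite uS lerDl ltW.
  - rewrite /v uS -addrA lerD2l.
    have : 2 / (qs k.+1)%:R ^+ 3 <= (qs k)%:R ^- 3 :> R.
      rewrite ler_pdivrMr ?exprn_gt0// mulrC ler_pdivlMr ?exprn_gt0//.
      rewrite [qs k.+1]/= -/(qs k) natrX.
      set q := (qs k)%:R : R; have h : 2 <= q := q2 k.
      have e1 : 1 <= q ^+ 3 by rewrite exprn_ege1//; lra.
      have e2 : 2 <= q ^+ 3 by rewrite exprSr; nra.
      by rewrite [leRHS]exprSr mulrC ler_pM//; [exact: le_trans e1|rewrite expr2; nra].
    by have := q3 k; lra.
  - by rewrite lerDl divr_ge0// exprn_ge0// ltW.
exists (sup (range u)); last first.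
  have := bnd 0; rewrite /v /u /ps/=.
  by set x := sup _; move=> /andP[h1 h2]; apply/andP; split; lra.
move=> e e0; pose k := Num.truncn (2 / e).
have kE : 2 / e < k.+1%:R by exact: truncnS_gt.
have /andP[_ b2] := bnd k; have /andP[b1 _] := bnd k.+1.
set x := sup _ in b1 b2 *.
have qk := qs_gt k.
exists (qs k)%:Z, (- (ps k)%:Z).
have E : (qs k)%:Z%:~R * x + (- (ps k)%:Z)%:~R = (qs k)%:R * (x - u k).
  rewrite rmorphN/= /u mulrBr mulrCA mulfV ?gt_eqF// mulr1.
  by [].
have x0 : 0 < x - u k.
  by rewrite subr_gt0; apply: lt_le_trans b1; rewrite uS ltrDl.
rewrite E ger0_norm; last by rewrite mulr_ge0// ltW.
split.
- by rewrite -lt0n; lia.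
- by rewrite coprimezE abszN; exact: qs_coprime.
- by rewrite mulr_gt0.
rewrite -[_%:~R]/((qs k)%:R) ger0_norm ?ler0n//.
apply: (@le_trans _ _ (2 / (qs k)%:R)).
  rewrite ler_pdivlMr//.
  have : x - u k <= 2 / (qs k)%:R ^+ 3 by rewrite /v in b2; lra.
  rewrite ler_pdivlMr ?exprn_gt0//; apply: le_trans; rewrite le_eqVlt.
  by apply/orP; left; apply/eqP; ring.
rewrite ler_pdivrMr// mulrC -ler_pdivrMr//; apply: ltW; apply: lt_trans kE _.
by rewrite ltr_nat.
Qed.

Lemma well_approx_addn (b : R) (n : nat) : well_approx b -> well_approx (n%:R + b).
Proof.
move=> wb e e0; have [q [p [q0 qp x0 qx]]] := wb _ e0.
exists q, (p - n%:Z * q).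
have E : q%:~R * (n%:R + b) + (p - n%:Z * q)%:~R = q%:~R * b + p%:~R.
  by rewrite rmorphB rmorphM/=; ring.
rewrite E; split => //; rewrite /coprimez.
by have := qp; rewrite /coprimez -mulNr addrC gcdzMDl.
Qed.

Lemma badly_approx_addn (c a : R) (n : nat) :
  badly_approx c a -> badly_approx c (n%:R + a).
Proof.
move=> ba q p q0; have := ba q (p + n%:Z * q) q0.
rewrite (_ : _ + (p + _)%:~R = q%:~R * (n%:R + a) + p%:~R)//.
by rewrite rmorphD rmorphM/=; ring.
Qed.

End existence_well_approx.

(** * A tree of badly approximable numbers *)

Section badly_approximable_tree.
Context {R : realType} (N : nat).
Hypothesis N5 : (5 <= N)%N.

(** The value for which the final estimate of [close_rationals_dist] closes, through
    [8 N^2 c = 1]. *)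
Definition bad_const : R := (8 * N%:R ^+ 2)^-1.

Let NR : 5 <= (N%:R : R). Proof. by rewrite ler_nat. Qed.
Let N0 : 0 < (N%:R : R). Proof. exact: lt_le_trans NR. Qed.
Let c0 : 0 < bad_const.
Proof. by rewrite invr_gt0 mulr_gt0// exprn_gt0. Qed.
Let cE : 8 * N%:R ^+ 2 * bad_const = 1.
Proof. by rewrite mulfV// gt_eqF// mulr_gt0// exprn_gt0. Qed.

(* At level k one avoids the fractions whose denominator is about N^(k/2), so
   that an interval of length N^-k is close to at most one of them. *)
Definition close_rational k (x : R) := exists q : nat, exists p : int,
  [/\ (0 < q)%N, (N ^ k.-1 <= 4 * q ^ 2 < N ^ k)%N &
      q%:R * `|q%:R * x + p%:~R| < bad_const].

Let no_nonzero_lt1 (z : int) : `|z%:~R| < (1 : R) -> z = 0.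
Proof.
by move=> h; apply: contraPP h => /eqP z0; apply/negP; rewrite -leNgt intr_norm_ge1.
Qed.

(* Here e = q x + p and e' = q' x' + p', z = q p' - q' p and K = N^k; the
   fractions p/q and p'/q' coincide because |z| < 1. *)
Let close_rationals_dist K (x x' q q' e e' : R) (z : int) : 0 < K ->
  0 < q -> 0 < q' -> K <= N%:R * (4 * q ^+ 2) -> 4 * q ^+ 2 < K ->
  K <= N%:R * (4 * q' ^+ 2) -> 4 * q' ^+ 2 < K ->
  q * `|e| < bad_const -> q' * `|e'| < bad_const ->
  `|x - x'| <= K^-1 -> z%:~R = q * e' - q' * e + q * q' * (x - x') ->
  `|x - x'| < (N%:R * K)^-1.
Proof.
move=> K0 q0 q'0 qK Kq q'K Kq' eb e'b xx zE; set c := bad_const in eb e'b.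
have c8 : 8 * N%:R * (N%:R * c) = 1 by apply: etrans cE; rewrite -/c; ring.
have Nc : N%:R * c <= 8^-1 / 5.
  have : 5 * (N%:R * c) <= N%:R * (N%:R * c) by rewrite ler_pM2r ?mulr_gt0.
  by lra.
have ratio s s' : 0 < s -> 0 < s' -> K <= N%:R * (4 * s' ^+ 2) ->
    4 * s ^+ 2 < K -> s <= N%:R * s'.
  move=> /ltW s0 /ltW s'0 h1 h2; have Ns0 : 0 <= N%:R * s' by rewrite mulr_ge0.
  rewrite -(@ler_pXn2r _ 2)// ?nnegrE//.
  have : s ^+ 2 <= N%:R * s' ^+ 2 by lra.
  move=> /le_trans; apply; rewrite exprMn ler_wpM2r ?exprn_ge0//.
  by rewrite expr2; nra.
have r1 := ratio _ _ q0 q'0 q'K Kq; have r2 := ratio _ _ q'0 q0 qK Kq'.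
have e0 := normr_ge0 e; have e'0 := normr_ge0 e'.
have t1 : q * `|e'| <= 8^-1.
  have : q * `|e'| <= N%:R * (q' * `|e'|) by rewrite mulrA ler_wpM2r.
  have : N%:R * (q' * `|e'|) <= N%:R * c by rewrite ler_wpM2l// ltW.
  lra.
have t2 : q' * `|e| <= 8^-1.
  have : q' * `|e| <= N%:R * (q * `|e|) by rewrite mulrA ler_wpM2r.
  have : N%:R * (q * `|e|) <= N%:R * c by rewrite ler_wpM2l// ltW.
  lra.
have qq : q * q' <= K / 4.
  have : 0 <= (q - q') ^+ 2 by rewrite sqr_ge0.
  rewrite !expr2 in Kq Kq' *; nra.
have t3 : q * q' * `|x - x'| <= 4^-1.
  have h : K * `|x - x'| <= 1 by rewrite mulrC -ler_pdivlMr// div1r.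
  have : q * q' * `|x - x'| <= K / 4 * `|x - x'| by rewrite ler_wpM2r.
  lra.
have z0 : z = 0.
  apply: no_nonzero_lt1; rewrite zE.
  have := ler_normD (q * e' - q' * e) (q * q' * (x - x')).
  have := ler_normB (q * e') (q' * e).
  rewrite !normrM (gtr0_norm q0) (gtr0_norm q'0); lra.
have E : q * q' * (x - x') = q' * e - q * e'.
  by move: zE; rewrite z0 mulr0z; lra.
have D : (q * q') ^+ 2 * `|x - x'| < (q ^+ 2 + q' ^+ 2) * c.
  have -> : (q * q') ^+ 2 * `|x - x'| = q * q' * `|q' * e - q * e'|.
    rewrite -E !normrM (gtr0_norm q0) (gtr0_norm q'0); ring.
  apply: (@le_lt_trans _ _ (q * q' * (q' * `|e| + q * `|e'|))).
    rewrite ler_pM2l ?mulr_gt0//; apply: le_trans (ler_normB _ _) _.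
    by rewrite !normrM (gtr0_norm q0) (gtr0_norm q'0).
  rewrite (_ : q * q' * _ = q' ^+ 2 * (q * `|e|) + q ^+ 2 * (q' * `|e'|)); last by ring.
  by rewrite addrC mulrDl ltrD// ltr_pM2l// exprn_gt0.
have q2 : 0 < q ^+ 2 by rewrite exprn_gt0.
have q'2 : 0 < q' ^+ 2 by rewrite exprn_gt0.
rewrite -[ltRHS]div1r ltr_pdivlMr ?mulr_gt0// -(@ltr_pM2l _ ((q * q') ^+ 2)); last first.
  by rewrite exprn_gt0// mulr_gt0.
rewrite mulr1 mulrA; apply: (@lt_le_trans _ _ ((q ^+ 2 + q' ^+ 2) * c * (N%:R * K))).
  by rewrite ltr_pM2r// mulr_gt0.
have -> : (q ^+ 2 + q' ^+ 2) * c * (N%:R * K) = (N%:R * c) * (q ^+ 2 * K + q' ^+ 2 * K).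
  ring.
apply: (@le_trans _ _ ((N%:R * c) * (8 * N%:R * (q * q') ^+ 2))).
  rewrite ler_pM2l ?mulr_gt0// exprMn.
  have : q ^+ 2 * K <= q ^+ 2 * (N%:R * (4 * q' ^+ 2)) by rewrite ler_pM2l.
  have : q' ^+ 2 * K <= q' ^+ 2 * (N%:R * (4 * q ^+ 2)) by rewrite ler_pM2l.
  lra.
by rewrite mulrCA [leLHS]mulrA c8 mul1r.
Qed.

Definition child k (z y : nat) (x : R) :=
  (N * z + y)%:R / N%:R ^+ k.+1 <= x <= (N * z + y).+1%:R / N%:R ^+ k.+1.

(** Let [u] be the least child containing a close point. Another one at [u + 2] or beyond would give
    two close points at distance between [N^-(k+1)] and [N^-k], against [close_rationals_dist]. If
    there is none, [N] serves as [u]. *)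
Lemma two_bad_children k z : exists u : nat, forall y : nat, (y < N)%N ->
  (y < u)%N || (u.+2 <= y)%N -> forall x, child k z y x -> ~ close_rational k x.
Proof.
pose unsafe y := `[< (y < N)%N /\ exists2 x, child k z y x & close_rational k x >].
have [ex|nex] := pselect (exists y, unsafe y); last first.
  exists N => y yN _ x cx crx; apply: nex; exists y; apply/asboolP; split => //.
  by exists x.
case: (ex_minnP ex) => u /asboolP[uN [x cx [q [p [q0 qN eq]]]]] umin.
exists u => y yN /orP[yu|uy] x' cx' [q' [p' [q'0 q'N eq']]].
  have := umin y; rewrite leqNgt yu => H; suff: false by []; apply: H.
  by apply/asboolP; split => //; exists x' => //; exists q', p'.
(* At level 0 the window [1 <= 4 q^2 < 1] is empty. *)
have k0 : (0 < k)%N.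
  by move: qN; case: (k) => // /andP[_]; rewrite expn0 ltnS leqn0 muln_eq0 /= expn_eq0; lia.
pose K : R := N%:R ^+ k; have K0 : 0 < K by rewrite exprn_gt0.
have NkE : N%:R ^+ k.+1 = N%:R * K by rewrite exprS.
have bnd s : (N ^ k.-1 <= 4 * s ^ 2 < N ^ k)%N ->
    K <= N%:R * (4 * s%:R ^+ 2) /\ 4 * s%:R ^+ 2 < K :> R.
  move=> /andP[h1 h2]; rewrite -natrX -!natrM /K -natrX ltr_nat ler_nat; split => //.
  by rewrite -(prednK k0) expnS leq_mul2l h1 orbT.
have [b1 b2] := bnd _ qN; have [b3 b4] := bnd _ q'N.
have NK0 : 0 < N%:R * K by rewrite mulr_gt0.
rewrite /child NkE in cx cx'; have /andP[x1 x2] := cx; have /andP[x3 x4] := cx'.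
rewrite ler_pdivrMr// in x1; rewrite ler_pdivlMr// in x2.
rewrite ler_pdivrMr// in x3; rewrite ler_pdivlMr// in x4.
rewrite -!natr1 natrD in x1 x2; rewrite -!natr1 natrD in x3 x4.
have yN' : y%:R + 1 <= (N%:R : R) by rewrite natr1 ler_nat.
have u0 : 0 <= (u%:R : R) by [].
have uy' : u%:R + 2 <= (y%:R : R) by rewrite -natrD ler_nat addn2.
have q0R : 0 < (q%:R : R) by rewrite ltr0n.
have q'0R : 0 < (q'%:R : R) by rewrite ltr0n.
have dx : `|x - x'| <= K^-1.
  rewrite -div1r ler_pdivlMr//.
  rewrite -(@ler_pM2l _ N%:R)// mulr1 mulrCA mulrC -[X in X * _](gtr0_norm NK0).
  by rewrite mulrC -normrM ler_norml; apply/andP; split; lra.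
have := @close_rationals_dist K x x' q%:R q'%:R (q%:R * x + p%:~R)
  (q'%:R * x' + p'%:~R) (q%:Z * p' - q'%:Z * p) K0 q0R q'0R b1 b2 b3 b4 eq eq' dx.
have -> : (q%:Z * p' - q'%:Z * p)%:~R = q%:R * (q'%:R * x' + p'%:~R) -
    q'%:R * (q%:R * x + p%:~R) + q%:R * q'%:R * (x - x') :> R.
  by rewrite rmorphB !rmorphM/=; ring.
move=> /(_ erefl); rewrite -[ltRHS]div1r ltr_pdivlMr// -[X in _ * X](gtr0_norm NK0).
rewrite -normrM ltNge => /negP; apply.
by rewrite -normrN (le_trans _ (ler_norm _))//; lra.
Qed.

Definition bad_digit k z : nat := projT1 (cid (two_bad_children k z)).

(** Every [e < N - 2] leads to a safe child, so each node of the tree has the same number of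
    branches. *)
Definition skip_digits k z (e : nat) : nat :=
  if (e < bad_digit k z)%N then e else e.+2.

Lemma skip_digits_lt k z e : (e < N - 2)%N -> (skip_digits k z e < N)%N.
Proof. by rewrite /skip_digits; case: ifP; lia. Qed.

Lemma skip_digits_inj k z : injective (skip_digits k z).
Proof. by move=> e e'; rewrite /skip_digits; case: ifP; case: ifP; lia. Qed.

Fixpoint skip_radix (e : nat -> nat) k : nat :=
  if k is k'.+1
  then (N * skip_radix e k' + skip_digits k' (skip_radix e k') (e k'))%N else 0%N.

Lemma skip_radix_step e k : (forall k, e k < N - 2)%N ->
  (N * skip_radix e k <= skip_radix e k.+1 < N * (skip_radix e k).+1)%N.
Proof.
move=> eN; have := skip_digits_lt k (skip_radix e k) (eN k).
by move=> h; rewrite /= leq_addr mulnS addnC ltn_add2r.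
Qed.

(** Each denominator [q] belongs to the window of exactly one level [k], and the digit chosen at
    that level keeps [x] away from its fractions. *)
Lemma skip_radix_badly_approx e : (forall k, e k < N - 2)%N ->
  badly_approx bad_const (radix_real N (skip_radix e) : R).
Proof.
move=> eN; set x := radix_real _ _.
have pos (q : nat) (p : int) : (0 < q)%N -> bad_const <= q%:R * `|q%:R * x + p%:~R|.
  move=> q0; rewrite leNgt; apply/negP => close.
  pose k := (trunc_log N (4 * q ^ 2)).+1.
  have /andP[h1 h2] : (N ^ k.-1 <= 4 * q ^ 2 < N ^ k)%N.
    by apply: trunc_log_bounds; [lia|rewrite muln_gt0 expn_gt0 q0].
  set z := skip_radix e k.
  have := projT2 (cid (two_bad_children k z)); rewrite -/(bad_digit k z) => H.
  apply: (H (skip_digits k z (e k)) _ _ x).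
  - exact: skip_digits_lt.
  - by rewrite /skip_digits; case: ifP => [->//|]; lia.
  - rewrite /child -natr1 mulrDl mul1r.
    have NN : (0 < N)%N by lia.
    exact: (radix_real_bounds k.+1 NN (fun j => skip_radix_step j eN)).
  - by exists q, p; split => //; rewrite h1 h2.
move=> q p q0; have q1 : (0 < `|q|)%N by rewrite absz_gt0.
have [qE|qE] : q = `|q|%N%:Z \/ q = - (`|q|%N%:Z) by lia.
  rewrite qE; apply: le_trans (pos _ p q1) _.
  by rewrite -[X in X * _]ger0_norm.
rewrite qE; apply: le_trans (pos _ (- p) q1) _.
rewrite !rmorphN normrN /= -[X in X * _]ger0_norm// -[X in _ <= _ * X]normrN.
by rewrite opprD mulNr opprK.
Qed.

End badly_approximable_tree.

(** * A mass distribution principle *)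

Section mass_distribution.
Context {R : realType}.
Local Notation mu := (@lebesgue_measure R).
Local Notation TR := (measurableTypeR R).
Local Open Scope ereal_scope.

Lemma diam_pow_ge0 (V : normedModType R) (s : R) (U : set V) :
  0 <= diam_pow s U.
Proof. by rewrite /diam_pow; case: ifP => // _; exact: poweR_ge0. Qed.

(** The mass is the image under [f] of Lebesgue measure on [G]. The sets [W] stand in for preimages
    of covering sets, which may fail to be measurable. A null measure would yield a cover of total
    mass below [r]. *)
Lemma hausdorff_measure_neq0 (V : normedModType R) (A : set V) (f : R -> V)
  (G : set TR) (C s r : R) : measurable G -> (0 < r)%R -> r%:E <= mu G ->
  (forall x, G x -> A (f x)) -> (0 < C)%R ->
  (forall U, diam U <= 1 -> exists W : set TR, [/\ measurable W,
     (forall x, G x -> U (f x) -> W x) & mu W <= C%:E * diam_pow s U]) ->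
  hausdorff_measure s A <> 0.
Proof.
move=> mG r0 rG GA C0 HU H0.
have : hausdorff_premeasure s 1 A < (r / C)%:E.
  apply: (@le_lt_trans _ _ 0); last by rewrite lte_fin divr_gt0.
  rewrite -H0; apply: ereal_sup_ubound; exists 1%R => //=.
move=> /ereal_inf_lt[_ [U [AU dU] <-] HS].
have /choice[W HW] i := HU _ (dU i).
have : r%:E < r%:E; last by rewrite ltxx.
apply: le_lt_trans rG _; apply: (@le_lt_trans _ _ (\sum_(0 <= i <oo) mu (W i))).
  apply: measure_sigma_subadditive => //.
    by move=> n; have [] := HW n.
  move=> x Gx; have [i _ Ui] := AU _ (GA _ Gx); exists i => //.
  by have [_ h _] := HW i; exact: h.
apply: (@le_lt_trans _ _ (\sum_(0 <= i <oo) (C%:E * diam_pow s (U i)))).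
  by apply: lee_nneseries => // n _; have [] := HW n.
rewrite nneseriesZl//; last by move=> i _; exact: diam_pow_ge0.
by rewrite -lte_pdivlMl// -EFinM mulrC.
Qed.

(** Continuity from above along the tail unions, whose measures are finite inside [0, 1). *)
Lemma limsup_lebesgue_ge (E : nat -> set TR) (r : R) :
  (forall k, measurable (E k)) -> (forall k, E k `<=` `[0%R, 1%R[%classic) ->
  (forall k, r%:E <= mu (E k)) -> r%:E <= mu (lim_sup_set E).
Proof.
move=> mE E01 rE.
have mU n : measurable (\bigcup_(k >= n) E k).
  by apply: bigcup_measurable => k _; exact: mE.
have := lim_sup_set_cvg mu E mE; set u := (fun n => mu _) => cu.
have fin : mu (\bigcup_(k >= 0) E k) < +oo.
  apply: (@le_lt_trans _ _ (mu `[0%R, 1%R[%classic)).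
    apply: le_measure; rewrite ?inE//.
    by move=> x [k _ /E01].
  by rewrite lebesgue_measure_itv/= lte_fin ltr01 -EFinB ltry.
have {}cu := cu fin; rewrite -(cvg_lim _ cu)//.
apply: lime_ge; first by apply/cvg_ex; eexists; exact: cu.
apply: nearW => n; apply: le_trans (rE n) _; apply: le_measure; rewrite ?inE//.
by move=> x Ex; exists n => /=.
Qed.

Lemma lebesgue_bigsetU_le (I : Type) (r : seq I) (P : pred I) (F : I -> set TR) :
  (forall i, measurable (F i)) ->
  mu (\big[setU/set0]_(i <- r | P i) F i) <= \sum_(i <- r | P i) mu (F i).
Proof.
move=> mF; elim: r => [|i r IH]; first by rewrite !big_nil measure0.
rewrite !big_cons; case: ifP => // _.
apply: le_trans (leeD2l _ IH); apply: measureU2 => //.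
exact: bigsetU_measurable.
Qed.

Definition cylinder H (P : {set 'I_H}) : set TR :=
  \bigcup_(a in [set` P]) `[(a%:R / H%:R)%R, (a.+1%:R / H%:R)%R[%classic.

Lemma measurable_cylinder H (P : {set 'I_H}) : measurable (cylinder P).
Proof.
rewrite /cylinder bigcup_pred.
by apply: bigsetU_measurable => a _; exact: measurable_itv.
Qed.

Lemma lebesgue_cylinder_le H (P : {set 'I_H}) : (0 < H)%N ->
  mu (cylinder P) <= (#|P|%:R / H%:R)%:E.
Proof.
move=> H0; have HR : (0 < H%:R :> R)%R by rewrite ltr0n.
rewrite /cylinder bigcup_pred.
apply: (le_trans (@lebesgue_bigsetU_le _ _ _ _ _)) => [i|]; first exact: measurable_itv.
rewrite (eq_bigr (fun=> (H%:R^-1)%:E)) => [|a _].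
  by rewrite sumEFin sumr_const mulr_natl.
rewrite lebesgue_measure_itv/= lte_fin ltr_pM2r ?invr_gt0// ltr_nat ltnSn.
by rewrite -EFinB -mulrBl -natr1 addrAC subrr add0r mul1r.
Qed.

Lemma cylinderP H (P : {set 'I_H}) (x : R) (a : 'I_H) : (0 < H)%N -> (0 <= x)%R ->
  Num.truncn (x * H%:R) = a -> a \in P -> cylinder P x.
Proof.
move=> H0 x0 xa aP; exists a => //=.
have HR : (0 < H%:R :> R)%R by rewrite ltr0n.
have xH : (0 <= x * H%:R)%R by rewrite mulr_ge0// ltW.
have /andP[h1 h2] := truncn_itv xH.
by rewrite in_itv/= ler_pdivrMr// ltr_pdivlMr// -xa h1 h2.
Qed.

Lemma cylinder_setC_ge H (P : {set 'I_H}) : (0 < H)%N -> (#|P|.*2 <= H)%N ->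
  (2^-1)%:E <= mu (`[0%R, 1%R[%classic `\` cylinder P).
Proof.
move=> H0 PH; have HR : (0 < H%:R :> R)%R by rewrite ltr0n.
have mI : measurable (`[0%R, 1%R[%classic : set TR) by exact: measurable_itv.
have mC := measurable_cylinder P.
have I1 : mu `[0%R, 1%R[%classic = 1.
  by rewrite lebesgue_measure_itv/= lte_fin ltr01 oppr0 adde0.
rewrite leNgt; apply/negP => lt.
have : mu `[0%R, 1%R[%classic < 1; last by rewrite I1 ltxx.
apply: (@le_lt_trans _ _ (mu (`[0%R, 1%R[%classic `\` cylinder P) + mu (cylinder P))).
  apply: (@le_trans _ _ (mu ((`[0%R, 1%R[%classic `\` cylinder P) `|` cylinder P))).
    apply: le_measure; rewrite ?inE//.
      by apply: measurableU => //; exact: measurableD.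
    by move=> x Ix; have [|] := pselect (cylinder P x); [right|left].
  by apply: measureU2 => //; exact: measurableD.
have Cle : mu (cylinder P) <= (2^-1)%:E.
  apply: le_trans (lebesgue_cylinder_le P H0) _.
  rewrite lee_fin ler_pdivrMr// mulrC ler_pdivlMr// -natrM muln2.
  by rewrite ler_nat.
have -> : 1 = (2^-1)%:E + (2^-1)%:E :> \bar R.
  by rewrite -EFinD; congr EFin; lra.
apply: lte_leD => //; rewrite ge0_fin_numE; last exact: measure_ge0.
by apply: le_lt_trans Cle _; exact: ltry.
Qed.

End mass_distribution.

(** * Coding [0, 1) by cubes *)

(** Choose a representative of each address; then pairs of an address and a parameter in [Y] inject
    into the codes [K]. [x0] is the default off the set of addresses. *)
Lemma card_fibers (X : Type) (x0 : X) (B : X -> nat) H (Y K : finType)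
    (Pr : X -> Prop) (h : X -> Y -> K) :
  (forall x x' y y', Pr x -> Pr x' -> h x y = h x' y' -> B x = B x' /\ y = y') ->
  (#|[set a : 'I_H | `[< exists x, Pr x /\ B x = a >]]%SET| * #|Y| <= #|K|)%N.
Proof.
move=> hinj; set P := (X in #|pred_of_set X|).
have /choice[g gP] : forall a : 'I_H, exists x, a \in P -> Pr x /\ B x = a.
  move=> a; have [|aP] := boolP (a \in P); last by exists x0.
  by rewrite inE => /asboolP[x ?]; exists x.
rewrite -cardsT -cardsX -(@card_in_imset _ _ (fun ay => h (g ay.1) ay.2)).
  exact: max_card.
move=> [a y] [a' y'] /setXP[/= aP _] /setXP[/= a'P _] /=.
have [Pa eqa] := gP _ aP; have [Pa' eqa'] := gP _ a'P.
move=> /(hinj _ _ _ _ Pa Pa')[eqB ->]; congr pair; apply: val_inj => /=.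
by rewrite -eqa -eqa'.
Qed.

Fixpoint radix (b : nat) (d : nat -> nat) k : nat :=
  if k is k'.+1 then (b * radix b d k' + d k')%N else 0%N.

Lemma radix_lt b d k : (forall k, d k < b)%N -> (radix b d k < b ^ k)%N.
Proof.
move=> db; elim: k => //= k IH; rewrite expnS.
by apply: (@leq_trans (b * (radix b d k).+1)); rewrite ?leq_mul2l ?IH ?orbT// mulnS
  addnC ltn_add2r.
Qed.

Lemma divmod_inj b q q' r r' : (r < b)%N -> (r' < b)%N ->
  (b * q + r = b * q' + r')%N -> q = q' /\ r = r'.
Proof.
move=> rb rb' e; have b0 : (0 < b)%N by exact: leq_ltn_trans rb.
have := congr1 (divn^~ b) e; have := congr1 (modn^~ b) e.
by rewrite ![(b * _)%N]mulnC !modnMDl !modn_small// !divnMDl// !divn_small// !addn0.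
Qed.

Lemma radix_inj b d d' k : (forall k, d k < b)%N -> (forall k, d' k < b)%N ->
  radix b d k = radix b d' k -> forall i, (i < k)%N -> d i = d' i.
Proof.
move=> db db'; elim: k => //= k IH /divmod_inj[]// /IH{}IH dk i.
by rewrite ltnS leq_eqVlt => /predU1P[->|/IH].
Qed.

Lemma skip_radix_inj (R : realType) N (N5 : (5 <= N)%N) e e' k :
  (forall k, e k < N - 2)%N -> (forall k, e' k < N - 2)%N ->
  @skip_radix R N N5 e k = @skip_radix R N N5 e' k -> forall i, (i < k)%N -> e i = e' i.
Proof.
move=> eN eN'; elim: k => //= k IH h.
have [eq] := divmod_inj (@skip_digits_lt R _ N5 k _ _ (eN k))
  (@skip_digits_lt R _ N5 k _ _ (eN' k)) h.
rewrite eq => /skip_digits_inj ek i.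
by rewrite ltnS leq_eqVlt => /predU1P[->//|]; exact: IH.
Qed.

Section coding.
Context {R : realType} (N : nat) (N5 : (5 <= N)%N) (J : finType).

Definition radix_base := ((N - 2) * N ^ #|J|)%N.
Local Notation S := radix_base.
Let T := ('I_(N - 2) * {ffun J -> 'I_N})%type.

Let N2 : (0 < N - 2)%N. Proof. by lia. Qed.
Let N0 : (0 < N)%N. Proof. by lia. Qed.
Let t0 : T := (Ordinal N2, [ffun=> Ordinal N0]).

Let cardT : #|{: T}| = S.
Proof. by rewrite card_prod card_ffun !card_ord. Qed.

Lemma radix_base_gt1 : (1 < S)%N.
Proof. by rewrite /S -[2%N]/(2 * 1)%N leq_mul// ?expn_gt0 ?N0//; lia. Qed.
Let S0 : (0 < S)%N. Proof. exact: ltn_trans radix_base_gt1. Qed.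

Implicit Types (x : R) (k : nat) (j : J).

Definition address k x : nat := Num.truncn (x * S%:R ^+ k).

Definition unit_itv x := 0 <= x < 1.

Lemma address_lt k x : unit_itv x -> (address k x < S ^ k)%N.
Proof.
move=> /andP[x0 x1]; have SR : 0 < (S%:R : R) ^+ k by rewrite exprn_gt0// ltr0n.
have xS : 0 <= x * S%:R ^+ k by rewrite mulr_ge0// ltW.
have /andP[h _] := truncn_itv xS.
by rewrite -(ltr_nat R) (le_lt_trans h)// natrX -[ltRHS]mul1r ltr_pM2r.
Qed.

Lemma address_div k x : 0 <= x -> (address k.+1 x %/ S)%N = address k x.
Proof.
move=> x0; have SR : 0 < (S%:R : R) by rewrite ltr0n.
have xS i : 0 <= x * S%:R ^+ i by rewrite mulr_ge0// exprn_ge0// ltW.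
apply/esym/truncn_def; have /andP[h1 h2] := truncn_itv (xS k.+1).
rewrite -/(address k.+1 x) in h1 h2.
set a := address k.+1 x in h1 h2 *; rewrite exprSr mulrA in h1 h2.
apply/andP; split.
  rewrite -(ler_pM2r SR) -natrM; apply: le_trans h1.
  by rewrite ler_nat leq_divM.
rewrite -(ltr_pM2r SR) -natrM; apply: lt_le_trans h2 _.
by rewrite ler_nat ltn_ceil.
Qed.

Definition digit k x : T := nth t0 (enum {: T}) (address k.+1 x %% S).

Lemma address_digits k x x' : 0 <= x -> 0 <= x' -> unit_itv x -> unit_itv x' ->
  (forall i, (i < k)%N -> digit i x = digit i x') -> address k x = address k x'.
Proof.
move=> x0 x'0 xu x'u; elim: k => [|k IH] h.
  have := address_lt 0 xu; have := address_lt 0 x'u.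
  by rewrite expn0 !ltnS !leqn0 => /eqP-> /eqP->.
rewrite (divn_eq (address k.+1 x) S) (divn_eq (address k.+1 x') S) !address_div//.
rewrite IH => [|i ik]; last by apply: h; exact: ltnW.
congr addn; apply/eqP; have := h k (ltnSn k); rewrite /digit => /eqP.
by rewrite nth_uniq ?enum_uniq// -cardE cardT ltn_mod.
Qed.

Definition free_digit j x i : nat := (digit i x).2 j.
Definition bad_digits x i : nat := (digit i x).1.

Lemma free_digit_lt j x i : (free_digit j x i < N)%N.
Proof. exact: ltn_ord. Qed.

Lemma bad_digits_lt x i : (bad_digits x i < N - 2)%N.
Proof. exact: ltn_ord. Qed.

Lemma address_inj k x x' : unit_itv x -> unit_itv x' ->
  (forall j, radix N (free_digit j x) k = radix N (free_digit j x') k) ->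
  (forall i, (i < k)%N -> bad_digits x i = bad_digits x' i) ->
  address k x = address k x'.
Proof.
move=> xu x'u hJ hb; have /andP[x0 _] := xu; have /andP[x'0 _] := x'u.
apply: address_digits => // i ik; rewrite [LHS]surjective_pairing.
rewrite [RHS]surjective_pairing; congr pair; first exact/val_inj/(hb i ik).
apply/ffunP => j; apply: val_inj.
exact: (radix_inj (free_digit_lt j x) (free_digit_lt j x') (hJ j) ik).
Qed.

Definition free_coord j x : R := radix_real N (radix N (free_digit j x)).
Definition bad_coord x : R := radix_real N (@skip_radix R N N5 (bad_digits x)).

Lemma free_coord_bounds j x k :
  (radix N (free_digit j x) k)%:R / N%:R ^+ k <= free_coord j x <=
  (radix N (free_digit j x) k)%:R / N%:R ^+ k + (N%:R ^+ k)^-1.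
Proof.
apply: radix_real_bounds => // i /=.
by rewrite leq_addr mulnS addnC ltn_add2r free_digit_lt.
Qed.

Lemma bad_coord_bounds x k :
  (@skip_radix R N N5 (bad_digits x) k)%:R / N%:R ^+ k <= bad_coord x <=
  (@skip_radix R N N5 (bad_digits x) k)%:R / N%:R ^+ k + (N%:R ^+ k)^-1.
Proof.
by apply: radix_real_bounds => // i; apply: skip_radix_step; exact: bad_digits_lt.
Qed.

(** A coordinate exceeds its prefix value by at most [N^-k], so prefixes of coordinates [N^-k] apart
    differ by at most 2. Hence [z + 2 - z'] is a true difference, with five possible values. *)
Let near_code (c c' : R) (z z' k : nat) :
  z%:R / N%:R ^+ k <= c <= z%:R / N%:R ^+ k + (N%:R ^+ k)^-1 ->
  z'%:R / N%:R ^+ k <= c' <= z'%:R / N%:R ^+ k + (N%:R ^+ k)^-1 ->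
  `|c - c'| <= (N%:R ^+ k)^-1 -> (z' <= z + 2)%N /\ (z + 2 - z' < 5)%N.
Proof.
have K0 : 0 < (N%:R : R) ^+ k by rewrite exprn_gt0// ltr0n.
move=> /andP[h1 h2] /andP[h3 h4]; rewrite ler_norml => /andP[h5 h6].
have KK : (N%:R ^+ k)^-1 * N%:R ^+ k = 1 :> R by rewrite mulVf// gt_eqF.
have e1 : z'%:R <= z%:R + 2 :> R.
  have : z'%:R / N%:R ^+ k <= (z%:R + 2) / N%:R ^+ k :> R by rewrite mulrDl; lra.
  by rewrite ler_pM2r// invr_gt0.
have e2 : z%:R <= z'%:R + 2 :> R.
  have : z%:R / N%:R ^+ k <= (z'%:R + 2) / N%:R ^+ k :> R by rewrite mulrDl; lra.
  by rewrite ler_pM2r// invr_gt0.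
move: e1 e2; rewrite -!natrD !ler_nat; lia.
Qed.

Let cover_code k x0 x : 'I_5 * {ffun J -> 'I_5} :=
  (inord (@skip_radix R N N5 (bad_digits x) k + 2 - @skip_radix R N N5 (bad_digits x0) k),
   [ffun j => inord (radix N (free_digit j x) k + 2 - radix N (free_digit j x0) k)]).

Definition cover_const : nat := (5 * 5 ^ #|J|)%N.

(** Relative to [x0] each of the [1 + #|J|] prefixes has five possible values, and together they
    determine the address. *)
Lemma cover_level (Q : R -> Prop) k x0 : unit_itv x0 ->
  (forall x, Q x -> [/\ unit_itv x, `|bad_coord x - bad_coord x0| <= (N%:R ^+ k)^-1 &
     forall j, `|free_coord j x - free_coord j x0| <= (N%:R ^+ k)^-1]) ->
  exists P : {set 'I_(S ^ k)}, (forall x, Q x -> cylinder P x) /\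
    (#|P| <= cover_const)%N.
Proof.
move=> x0u HQ.
exists [set a : 'I_(S ^ k) | `[< exists x, Q x /\ address k x = a >]]%SET; split.
  move=> x Qx; have [xu _ _] := HQ _ Qx; have /andP[x_ge0 _] := xu.
  apply: (@cylinderP _ _ _ x (Ordinal (address_lt k xu))) => //.
  - by rewrite expn_gt0 S0.
  - by rewrite natrX.
  - by rewrite inE; apply/asboolP; exists x.
have := @card_fibers _ x0 (address k) (S ^ k) unit _ Q (fun x _ => cover_code k x0 x).
rewrite card_unit muln1 card_prod card_ffun !card_ord; apply.
move=> x x' [] [] /HQ[xu b f] /HQ[x'u b' f'] [].
have [b1 b2] := near_code (bad_coord_bounds x k) (bad_coord_bounds x0 k) b.
have [b'1 b'2] := near_code (bad_coord_bounds x' k) (bad_coord_bounds x0 k) b'.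
move=> /(congr1 val); rewrite /= !inordK// => eb /ffunP ef; split=> //.
apply: address_inj => // [j|]; last first.
  by apply: (@skip_radix_inj R N N5 _ _ k (bad_digits_lt x) (bad_digits_lt x')); lia.
have [f1 f2] := near_code (free_coord_bounds j x k) (free_coord_bounds j x0 k) (f j).
have [f'1 f'2] := near_code (free_coord_bounds j x' k) (free_coord_bounds j x0 k) (f' j).
have := congr1 val (ef j); rewrite !ffunE /= !inordK// => ej; lia.
Qed.

End coding.

(** * From diameters in the space of matrices to Lebesgue measure *)

Section cover.
Context {R : realType} (N : nat) (N5 : (5 <= N)%N) (J : finType).
Context {V : normedModType R} (g : R -> V) (s : R).
Local Notation S := (radix_base N J).
Local Notation mu := (@lebesgue_measure R).
Local Notation TR := (measurableTypeR R).

Let NR : 1 < (N%:R : R). Proof. by rewrite ltr1n; lia. Qed.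
Let N0 : 0 < (N%:R : R). Proof. exact: lt_trans NR. Qed.
Let S1 : 1 < (S%:R : R). Proof. by rewrite ltr1n radix_base_gt1. Qed.
Let S0 : 0 < (S%:R : R). Proof. exact: lt_trans S1. Qed.

Let exp_gt (b e : R) : 1 < b -> 0 < e -> exists k, (b ^+ k)^-1 < e.
Proof.
move=> b1 e0; have b0 : 0 < b by exact: lt_trans b1.
exists (Num.bound (e^-1 / (b - 1))).
set k := Num.bound _; have kE : e^-1 / (b - 1) < k%:R.
  by apply: archi_boundP; rewrite divr_ge0 ?invr_ge0 ?subr_ge0 ?(ltW e0) ?(ltW b1).
have bern : 1 + k%:R * (b - 1) <= b ^+ k.
  elim: (k) => [|j IH]; first by rewrite mul0r addr0 expr0.
  rewrite exprS -natr1; have j0 : 0 <= (j%:R : R) by [].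
  apply: (@le_trans _ _ (b * (1 + j%:R * (b - 1)))).
    have : 0 <= j%:R * ((b - 1) * (b - 1)) by rewrite mulr_ge0// -expr2 sqr_ge0.
    by lra.
  by rewrite ler_pM2l.
rewrite -[ltRHS]invrK ltf_pV2 ?posrE ?invr_gt0 ?exprn_gt0//.
move: kE; rewrite ltr_pdivrMr ?subr_gt0// => /lt_le_trans; apply.
by apply: le_trans bern; rewrite lerDr.
Qed.

Hypothesis Ns : powR N%:R s <= S%:R.
Hypothesis s0 : 0 <= s.
Hypothesis g_bad : forall x x', unit_itv x -> unit_itv x' ->
  `|bad_coord N5 J x - bad_coord N5 J x'| <= `|g x - g x'|.
Hypothesis g_free : forall (j : J) x x', unit_itv x -> unit_itv x' ->
  `|free_coord N5 j x - free_coord N5 j x'| <= `|g x - g x'|.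

Lemma diam_le_dist (U : set V) (r : R) x y : (diam U <= r%:E)%E ->
  U x -> U y -> `|x - y| <= r.
Proof.
move=> Ur Ux Uy; rewrite -lee_fin; apply: le_trans Ur.
by apply: ereal_sup_ubound; exists x => //; exists y.
Qed.

Let cover_k (U : set V) k : (diam U <= ((N%:R ^+ k)^-1)%:E)%E ->
  (exists2 x0, unit_itv x0 & U (g x0)) ->
  exists W : set TR, [/\ measurable W, forall x, unit_itv x -> U (g x) -> W x &
    (mu W <= ((cover_const J)%:R / S%:R ^+ k)%:E)%E].
Proof.
move=> dU [x0 x0u Ux0].
have [|P [HP cP]] := @cover_level R N N5 J (fun x => unit_itv x /\ U (g x)) k x0 x0u.
  move=> x [xu Ux]; have d := diam_le_dist dU Ux Ux0; split => // [|j].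
    exact: le_trans (g_bad xu x0u) d.
  exact: le_trans (g_free j xu x0u) d.
exists (cylinder P); split; first exact: measurable_cylinder.
  by move=> x xu Ux; exact: HP.
have Sk : (0 < S ^ k)%N by rewrite expn_gt0 ltnW ?radix_base_gt1.
apply: le_trans (lebesgue_cylinder_le P Sk) _.
by rewrite lee_fin natrX ler_pM2r ?invr_gt0 ?exprn_gt0// ler_nat.
Qed.

(** Choose [k] with [N^-(k+1) < diam U <= N^-k]. The cover of level [k] has measure at most a
    constant times [S^-k = S * S^-(k+1)], and [S^-(k+1) <= N^(-s(k+1)) <= (diam U)^s]. *)
Lemma cover_diam (U : set V) : (diam U <= 1)%E ->
  exists W : set TR, [/\ measurable W, forall x, unit_itv x -> U (g x) -> W x &
    (mu W <= (((cover_const J) * S)%:R)%:E * diam_pow s U)%E].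
Proof.
move=> U1; have [ne|e] := pselect (exists2 x0, unit_itv x0 & U (g x0)); last first.
  exists set0; split => //; first by move=> x xu Ux; apply: e; exists x.
  by rewrite measure0 mule_ge0// ?lee_fin// diam_pow_ge0.
have C0 : 0 < ((cover_const J)%:R : R) by rewrite ltr0n muln_gt0 expn_gt0.
have [x0 x0u Ux0] := ne.
have U0 : U != set0 by apply/set0P; exists (g x0).
have dge0 : (0 <= diam U)%E.
  by apply: ereal_sup_ubound; exists (g x0) => //; exists (g x0) => //; rewrite subrr normr0.
have [r rE] : exists r : R, diam U = r%:E.
  exists (fine (diam U)); rewrite fineK// fin_real//.
  by rewrite (lt_le_trans _ dge0)// (le_lt_trans U1)// ltry.
have r0 : 0 <= r by rewrite -lee_fin -rE.
have r1 : r <= 1 by rewrite -lee_fin -rE.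
(* At diameter 0 no level is singled out; covers exist at all levels and their intersection is
   null. *)
have [req|rne] := eqVneq r 0.
  have /choice[W HW] : forall k, exists W : set TR, [/\ measurable W,
      forall x, unit_itv x -> U (g x) -> W x &
      (mu W <= ((cover_const J)%:R / S%:R ^+ k)%:E)%E].
    by move=> k; apply: cover_k => //; rewrite rE req lee_fin invr_ge0 exprn_ge0// ltW.
  exists (\bigcap_k W k); split.
  - by apply: bigcapT_measurable => k; have [] := HW k.
  - by move=> x xu Ux k _; have [_ h _] := HW k; exact: h.
  apply: (@le_trans _ _ 0%E); last by rewrite mule_ge0// ?lee_fin// diam_pow_ge0.
  apply/lee_addgt0Pr => e e0; rewrite add0e.
  have [k ke] := exp_gt S1 (divr_gt0 e0 C0).
  have [mW _ Wk] := HW k.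
  apply: (@le_trans _ _ (mu (W k))).
    apply: le_measure; rewrite ?inE//.
      by apply: bigcapT_measurable => j; have [] := HW j.
    exact: bigcap_inf.
  by apply: le_trans Wk _; rewrite lee_fin mulrC -ler_pdivlMr// ltW.
have {rne}r_gt0 : 0 < r by rewrite lt_def rne.
have [m mr] := exp_gt NR r_gt0.
have ex : exists k, (N%:R ^+ k.+1)^-1 < r.
  exists m; apply: le_lt_trans mr; rewrite lef_pV2 ?posrE ?exprn_gt0//.
  by rewrite ler_eXn2l.
(* Minimality gives [r <= N^-k], or [r <= 1] does when [k = 0]. *)
case: (ex_minnP ex) => k kr kmin.
have rk : r <= (N%:R ^+ k)^-1.
  case: k kr kmin => [|k] kr kmin; first by rewrite expr0 invr1.
  by rewrite leNgt; apply/negP => /kmin; rewrite ltnn.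
have [|W [mW HW Wk]] := @cover_k U k _ ne; first by rewrite rE lee_fin.
exists W; split => //; apply: le_trans Wk _.
rewrite /diam_pow (negPf U0) rE poweR_EFin -EFinM lee_fin natrM -mulrA.
rewrite ler_pM2l//.
have -> : (S%:R ^+ k)^-1 = S%:R * (S%:R ^+ k.+1)^-1 :> R.
  by rewrite exprS invfM mulVKf// gt_eqF.
rewrite ler_pM2l//.
apply: (@le_trans _ _ ((N%:R ^+ k.+1)^-1 `^ s)); last first.
  by apply: ge0_ler_powR; rewrite ?nnegrE ?invr_ge0 ?exprn_ge0// ltW.
have -> : (N%:R ^+ k.+1)^-1 `^ s = (((N%:R : R) `^ s) ^+ k.+1)^-1.
  rewrite -(@powR_mulrn _ (N%:R : R)) ?ler0n// -powRN -powRrM [_ * s]mulrC.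
  by rewrite powRrM powRN powR_mulrn// powR_ge0.
rewrite lef_pV2 ?posrE ?exprn_gt0 ?powR_gt0//.
by apply: lerXn2r; rewrite ?nnegrE ?powR_ge0// ltW.
Qed.

End cover.

(** * Counting exceptional blocks *)

Section residues.

(** The two codes locate [a + b * x] up to less than [b]. *)
Let divn_modn_code_inj a b L x x' : (0 < b)%N -> (0 < L)%N ->
  ((a + b * x) %/ L = (a + b * x') %/ L)%N ->
  ((a + b * x) %% L %/ b = (a + b * x') %% L %/ b)%N -> x = x'.
Proof.
move=> b0 L0 hq hr.
have e := divn_eq (a + b * x) L; have e' := divn_eq (a + b * x') L.
have f := divn_eq ((a + b * x) %% L) b; have f' := divn_eq ((a + b * x') %% L) b.
have m := ltn_pmod ((a + b * x) %% L) b0.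
have m' := ltn_pmod ((a + b * x') %% L) b0.
rewrite hq in e; rewrite hr in f.
have d : (b * x < b * x'.+1)%N by rewrite mulnS; lia.
have d' : (b * x' < b * x.+1)%N by rewrite mulnS; lia.
by move: d d'; rewrite !ltn_pmul2l// !ltnS; lia.
Qed.

(* When A + b x is within W of a multiple of L, its quotient and remainder by L
   determine x among O(b + W) possibilities; the code records the quotient and
   the remainder up to b, after A is shifted by W and reduced modulo L. *)
Definition residue_code (A : int) (b W L x : nat) : nat * nat :=
  let r := (`|((A + W%:Z) %% L%:Z)%Z| + b * x)%N in ((r %/ L)%N, (r %% L %/ b)%N).

Lemma residue_code_inj A b W L x x' : (0 < b)%N -> (0 < L)%N ->
  residue_code A b W L x = residue_code A b W L x' -> x = x'.
Proof. by move=> b0 L0 [] /divn_modn_code_inj; apply. Qed.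

(** After the shift by [W], the remainder is an integer in [[0, 2 W]]; the quotient is at most [b]
    since [a + b x < (b + 1) L]. *)
Lemma residue_code_lt A (b W L x : nat) (c : int) : (0 < b)%N -> (x < L)%N ->
  (2 * W < L)%N -> `|A + b%:Z * x%:Z + c * L%:Z| <= W%:Z ->
  ((residue_code A b W L x).1 < b.+1)%N /\
  ((residue_code A b W L x).2 < (2 * W %/ b).+1)%N.
Proof.
move=> b0 xL WL h; have L0 : (0 < L)%N by exact: leq_ltn_trans xL.
rewrite /residue_code /=; set a := `|((A + W%:Z) %% L%:Z)%Z|%N.
have L0' : L%:Z != 0 by rewrite lt0r_neq0.
have aE : a%:Z = ((A + W%:Z) %% L%:Z)%Z by rewrite /a gez0_abs// modz_ge0.
have aL : (a < L)%N by rewrite -ltz_nat aE ltz_pmod.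
split.
  rewrite ltn_divLR//; apply: (@leq_trans (L + b * L)%N); last by rewrite mulSn.
  by apply: (@leq_trans (L + b * x)%N); rewrite ?ltn_add2r// leq_add2l leq_mul2l ltnW ?orbT.
rewrite ltnS; apply: leq_div2r.
have [v vE] : exists v : nat, (v <= 2 * W)%N /\
    v%:Z = A + W%:Z + b%:Z * x%:Z + c * L%:Z.
  by exists (absz (A + W%:Z + b%:Z * x%:Z + c * L%:Z)); split; lia.
suff -> : ((a + b * x) %% L)%N = v by case: vE.
have vL : (v < L)%N by case: vE => ? _; lia.
apply/eqP; rewrite -(modn_small vL); apply/eqP.
suff : (((a + b * x)%N)%:Z = v%:Z %[mod L%:Z])%Z.
  by rewrite !modz_nat => -[].
rewrite PoszD aE PoszM (proj2 vE) modzDml.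
by rewrite [in RHS]addrC modzMDl.
Qed.

End residues.

Section counting.
Context {R : realType} (N : nat) (N5 : (5 <= N)%N) (I J : finType).
Context (emb : I -> I -> J) (K tau W : nat).
Hypothesis emb_inj : forall i j i' j', emb i j = emb i' j' -> i = i' /\ j = j'.
Local Notation S := (radix_base N J).
Let L := (N ^ K)%N.

Definition block_entry (x : R) i j : nat := radix N (free_digit N5 (emb i j) x) K.

(* Multiplied by N^K, the condition that all the rows of the middle block
   truncated at level K take at b values close to integers. *)
Definition small_on (b : I -> int) (x : R) := forall i, exists c : int,
  `|\sum_j (block_entry x i j)%:Z * b j + c * L%:Z| <= W%:Z.

Let L0 : (0 < L)%N. Proof. by rewrite expn_gt0; lia. Qed.

Let addresses (Pr : R -> Prop) : {set 'I_(S ^ K)} :=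
  [set a : 'I_(S ^ K) | `[< exists x, (unit_itv x /\ Pr x) /\ address N J K x = a >]]%SET.

(* The entries of column j0 are recovered from their codes and the other
   entries; the free parameter y counts the L^#|I| values that they leave. *)
Lemma card_small_on b j0 : b j0 != 0 -> (2 * W < L)%N ->
  (#|addresses (small_on b)| * L ^ #|I| <=
   S ^ K * (`|b j0|.+1 * (2 * W %/ `|b j0|).+1) ^ #|I|)%N.
Proof.
move=> bj0 WL; set B := `|b j0|%N.
have B0 : (0 < B)%N by rewrite absz_gt0.
(* Changing the sign of the whole form makes the coefficient of the unknown entry equal to [B > 0],
   as the residue code requires. *)
pose sgn (z : int) := if 0 < b j0 then z else - z.
pose A x i := sgn (\sum_(j | j != j0) (block_entry x i j)%:Z * b j).
pose zJ (j : J) (x : R) : 'I_L := Ordinal (radix_lt K (free_digit_lt N5 j x)).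
pose ze (x : R) : 'I_((N - 2) ^ K) := Ordinal (radix_lt K (bad_digits_lt N5 J x)).
pose code x i := residue_code (A x i) B W L (block_entry x i j0).
pose h x (y : {ffun I -> 'I_L}) :
    'I_((N - 2) ^ K) * {ffun J -> 'I_L} * {ffun I -> 'I_(B.+1) * 'I_((2 * W %/ B).+1)} :=
  (ze x, [ffun j => if [pick i | emb i j0 == j] is Some i then y i else zJ j x],
   [ffun i => (inord (code x i).1, inord (code x i).2)]).
have codeP x i : small_on b x ->
    ((code x i).1 < B.+1)%N /\ ((code x i).2 < (2 * W %/ B).+1)%N.
  move=> /(_ i)[c]; rewrite (bigD1 j0)//= => hc.
  have xL : (block_entry x i j0 < L)%N by apply: radix_lt; exact: free_digit_lt.
  apply: (@residue_code_lt _ _ _ _ _ (sgn c)) => //.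
  have sgn_norm z : `|sgn z| = `|z| by rewrite /sgn; case: ifP; rewrite ?normrN.
  have BE : B%:Z = sgn (b j0).
    by rewrite /B /sgn; case: ifP => [/gtz0_abs//|/negbT]; rewrite -leNgt => /lez0_abs.
  apply: le_trans hc; rewrite -[leRHS]sgn_norm BE /A /sgn.
  by case: ifP => _; rewrite le_eqVlt; apply/orP; left; apply/eqP; congr `|_|; ring.
have := @card_fibers _ 0 (address N J K) (S ^ K) {ffun I -> 'I_L} _
  (fun x => unit_itv x /\ small_on b x) h.
rewrite !card_prod !card_ffun card_prod !card_ord.
have -> : ((N - 2) ^ K * L ^ #|J| = S ^ K)%N.
  by rewrite /L /S expnMn -!expnM mulnC [(K * _)%N]mulnC mulnC.
apply => x x' y y' [xu xs] [x'u x's] [eze /ffunP ezJ /ffunP ecode].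
have pickE i : [pick i' | emb i' j0 == emb i j0] = Some i.
  case: pickP => [i' /eqP/emb_inj[->]//|/(_ i)]; by rewrite eqxx.
have yy : y = y'.
  by apply/ffunP => i; have := ezJ (emb i j0); rewrite !ffunE pickE.
split => //.
have off j : (forall i, emb i j0 != j) ->
    radix N (free_digit N5 j x) K = radix N (free_digit N5 j x') K.
  move=> jN; have := ezJ j; rewrite !ffunE; case: pickP => [i /eqP ij|_].
    by have := jN i; rewrite ij eqxx.
  by move=> /(congr1 val).
have AA i : A x i = A x' i.
  rewrite /A; congr sgn; apply: eq_bigr => j jj0; congr (_%:Z * _).
  apply: off => i'; apply/eqP => /emb_inj[_ jj]; by rewrite jj eqxx in jj0.
have on i : block_entry x i j0 = block_entry x' i j0.
  have := ecode i; rewrite !ffunE => -[].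
  have [c1 c2] := codeP x i xs; have [c'1 c'2] := codeP x' i x's.
  move=> /(congr1 val); rewrite /= !inordK// => e1 /(congr1 val).
  rewrite /= !inordK// => e2; apply: (@residue_code_inj (A x i) B W L) => //.
  by rewrite [LHS]surjective_pairing [RHS]surjective_pairing {3 4}AA; congr pair.
apply: (address_inj (N5 := N5)) => //.
  move=> j; have [[i ij]|jN] := pselect (exists i, emb i j0 = j).
    by rewrite -ij; exact: on.
  by apply: off => i; apply/eqP => ij; apply: jN; exists i.
exact: (radix_inj (bad_digits_lt N5 J x) (bad_digits_lt N5 J x') eze).
Qed.

Let leq_expMn m n e : (m <= n)%N -> (m ^ e <= n ^ e)%N.
Proof. by case: e => // e mn; rewrite leq_exp2r. Qed.

Let code_count B v : (0 < B)%N -> (B <= tau)%N -> (v * B <= 2 * W)%N ->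
  (B.+1 * v.+1 <= 4 * W + 2 * tau)%N.
Proof.
move=> B0 Bt vB; have : (v <= v * B)%N by rewrite leq_pmulr.
by rewrite mulSn mulnS [(B * v)%N]mulnC; lia.
Qed.

Let scale_bound : (0 < tau)%N -> (30 * tau * W <= L)%N -> (60 * tau ^ 2 <= L)%N ->
  (2 * (2 * tau).+1 * (4 * W + 2 * tau) <= L)%N.
Proof.
move=> t0 h1 h2; apply: (@leq_trans (6 * tau * (4 * W + 2 * tau))).
  by rewrite leq_mul2r; apply/orP; right; lia.
by rewrite mulnDr; move: h2; rewrite -mulnn; lia.
Qed.

Let card_bigcup_leq (T F : finType) (P : F -> {set T}) :
  (#|(\bigcup_(f : F) P f)%SET| <= \sum_(f : F) #|P f|)%N.
Proof.
elim/big_rec2 : _ => [|f n A _ IH]; first by rewrite cards0.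
by rewrite cardsU; apply: leq_trans (leq_subr _ _) _; rewrite leq_add2l.
Qed.

Definition small_somewhere (x : R) := exists b : I -> int,
  [/\ exists j, b j != 0, (forall j, `|b j| <= tau%:Z) & small_on b x].

(** There are [(2 tau + 1)^#|I|] vectors [b], and each one excludes at most a fraction [q^-#|I|] of
    the addresses, where [q = 2 (2 tau + 1)]. The total fraction is at most [2^-#|I|]. *)
Lemma card_small_somewhere : (0 < tau)%N -> W = (L %/ (30 * tau))%N ->
  (60 * tau ^ 2 <= L)%N ->
  (#|addresses small_somewhere|.*2 <= S ^ K)%N.
Proof.
move=> tau0 WE LE.
have LW : (30 * tau * W <= L)%N by rewrite WE mulnC leq_divM.
have WL : (2 * W < L)%N by nia.
pose dec (f : {ffun I -> 'I_(2 * tau).+1}) i : int := (f i)%:Z - tau%:Z.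
pose P f := addresses (fun x => (exists j, dec f j != 0) /\ small_on (dec f) x).
pose q := (2 * (2 * tau).+1)%N.
have PK f : (#|P f| * q ^ #|I| <= S ^ K)%N.
  have [[j bj]|b0] := pselect (exists j, dec f j != 0); last first.
    suff -> : P f = finset.set0 by rewrite cards0.
    by apply/finset.setP => a; rewrite !inE; apply/asboolP => -[x [[_ []]]].
  have sub : (#|P f| <= #|addresses (small_on (dec f))|)%N.
    apply/subset_leq_card/fintype.subsetP => a; rewrite !inE => -[x [[xu [_ xs]] xa]].
    by exists x.
  have card := leq_trans (leq_mul sub (leqnn (L ^ #|I|))) (card_small_on bj WL).
  set B := `|dec f j|%N in card; set k := (B.+1 * (2 * W %/ B).+1)%N in card.
  have qk : (q * k <= L)%N.
    have B1 : (0 < B)%N by rewrite absz_gt0.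
    have Bt : (B <= tau)%N by rewrite /B /dec; have := ltn_ord (f j); lia.
    have kle := code_count B1 Bt (leq_divM (2 * W) B).
    by apply: leq_trans (scale_bound tau0 LW LE); rewrite leq_mul2l kle orbT.
  have LI : (0 < L ^ #|I|)%N by rewrite expn_gt0 L0.
  rewrite -(leq_pmul2r LI) -mulnA [(q ^ _ * _)%N]mulnC mulnA.
  apply: (@leq_trans (S ^ K * k ^ #|I| * q ^ #|I|)); first by rewrite leq_mul2r card orbT.
  by rewrite -mulnA -expnMn leq_mul2l [(k * q)%N]mulnC leq_expMn ?orbT.
have sub : (#|addresses small_somewhere| <= \sum_f #|P f|)%N.
  apply: leq_trans (card_bigcup_leq P); apply/subset_leq_card/fintype.subsetP => a.
  rewrite inE => /asboolP[x [[xu [b [[j bj] bt xs]]] xa]].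
  pose f : {ffun I -> 'I_(2 * tau).+1} := [ffun i => inord (absz (b i + tau%:Z))].
  have fb : dec f = b.
    apply/funext => i; rewrite /dec ffunE inordK.
      by have := bt i; lia.
    by have := bt i; lia.
  apply/finset.bigcupP; exists f => //; rewrite inE; apply/asboolP; exists x.
  by rewrite fb; split => //; split => //; split => //; exists j.
(* With an empty middle block [2^-#|I|] is 1, but then no nonzero [b] exists and nothing is
   excluded. *)
have [I0|I0] := posnP #|I|.
  rewrite (_ : #|_| = 0)%N// ; apply/eqP; rewrite -leqn0; apply: leq_trans sub _.
  rewrite leqn0 sum_nat_eq0; apply/forallP => f; apply/implyP => _.
  rewrite cards_eq0; apply/eqP/finset.setP => a; rewrite !inE; apply/asboolP.
  move=> [x [[_ [[j _] _]] _]].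
  by have := card0_eq I0 j; rewrite inE.
have /(leq_trans _) : (\sum_f #|P f| * q ^ #|I| <=
    \sum_(f : {ffun I -> 'I_(2 * tau).+1}) S ^ K)%N.
  by apply: leq_sum.
have qI : (0 < (2 * tau).+1 ^ #|I|)%N by rewrite expn_gt0.
move=> /(_ _ (leqnn _)); rewrite -big_distrl sum_nat_const /= card_ffun card_ord.
rewrite /q expnMn mulnA [leqRHS]mulnC leq_pmul2r// => h.
apply: leq_trans h; rewrite -muln2; apply: leq_mul => //.
by rewrite -{1}(expn1 2) leq_exp2l.
Qed.

End counting.

(** * The family of matrices *)

Section truncation.
Context {R : realType} (I : finType).

(** After multiplication by [L], each truncation error lies in [0, 1] and is weighted by at most
    [tau], while the integer form is at least [W + 1] in absolute value. *)
Lemma truncated_form_ge (xi : I -> R) (X : I -> nat) (b : I -> int) (c : int)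
    (L W tau : nat) : (0 < L)%N ->
  (forall j, (X j)%:R / L%:R <= xi j <= (X j)%:R / L%:R + L%:R^-1) ->
  (forall j, `|b j| <= tau%:Z) ->
  W%:Z < `|\sum_j (X j)%:Z * b j + c * L%:Z| ->
  (W.+1%:R - (#|I| * tau)%:R) / L%:R <= `|\sum_j xi j * (b j)%:~R + c%:~R|.
Proof.
move=> L0 Xxi bt WX; have LR : 0 < (L%:R : R) by rewrite ltr0n.
rewrite ler_pdivrMr// -[X in _ * X]gtr0_norm// -normrM mulrDl mulr_suml.
pose err j := xi j * L%:R - (X j)%:R.
have err01 j : `|err j * (b j)%:~R| <= tau%:R.
  have /andP[h1 h2] := Xxi j.
  rewrite ler_pdivrMr// in h1.
  have {}h2 : xi j * L%:R <= (X j)%:R + 1.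
    by rewrite -ler_pdivlMr// mulrDl mul1r.
  have e1 : `|err j| <= 1 by rewrite ler_norml /err; apply/andP; split; lra.
  rewrite normrM -[leRHS]mul1r; apply: ler_pM => //.
  by rewrite -intr_norm -[tau%:R]/((tau%:Z)%:~R) ler_int.
have -> : \sum_j xi j * (b j)%:~R * L%:R + c%:~R * L%:R =
    (\sum_j (X j)%:Z * b j + c * L%:Z)%:~R + \sum_j err j * (b j)%:~R.
  rewrite rmorphD rmorphM raddf_sum /= addrAC -big_split/=; congr (_ + _).
  by apply: eq_bigr => j _; rewrite rmorphM/= /err; ring.
have E : `|\sum_j err j * (b j)%:~R| <= (#|I| * tau)%:R.
  apply: le_trans (ler_norm_sum _ _ _) _.
  apply: le_trans (ler_sum _ (fun j _ => err01 j)) _.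
  by rewrite sumr_const natrM mulr_natl.
have Z : W.+1%:R <= `|(\sum_j (X j)%:Z * b j + c * L%:Z)%:~R : R|.
  by rewrite -intr_norm -[W.+1%:R]/((W.+1%:Z)%:~R) ler_int; move: WX; lia.
have := lerB_normD ((\sum_j (X j)%:Z * b j + c * L%:Z)%:~R : R)
  (\sum_j err j * (b j)%:~R).
lra.
Qed.

End truncation.

Section positions.
Context {m : nat}.

Local Notation n := m.+2.
Let omax : 'I_n := ord_max.

Definition middle : {pred 'I_n} := [pred i | (i != 0) && (i != omax)].

Definition free_position : pred ('I_n * 'I_n) :=
  [pred p | (p.2 \in middle) || (p == (omax, 0))].

Local Notation I := {i : 'I_n | i \in middle}.
Local Notation J := {p : 'I_n * 'I_n | free_position p}.

Let middle_omax : (omax \in middle) = false.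
Proof. by rewrite inE eqxx andbF. Qed.

Lemma card_middle : #|middle| = m.
Proof.
have := cardC [predU1 (0 : 'I_n) & pred1 omax]; rewrite card_ord cardU1 card1 inE.
rewrite (_ : #|predC _| = #|middle|); first by move=> /= [].
by apply: eq_card => i; rewrite !inE negb_or.
Qed.

(** The [m] middle columns have [m + 2] entries each, and the bottom left corner adds one. *)
Lemma card_free_position : #|{: J}| = (m.+1 ^ 2)%N.
Proof.
rewrite card_sig.
rewrite (@eq_card _ _ [predU1 (omax, (0 : 'I_n)) & [predX 'I_n & middle]]); last first.
  by move=> p; rewrite !inE orbC.
rewrite cardU1 cardX card_ord card_middle !inE /=; lia.
Qed.

Lemma block_position (i j : I) : free_position (val i, val j).
Proof. by apply/orP; left; exact: valP j. Qed.

Definition block_emb (i j : I) : J := exist _ (val i, val j) (block_position i j).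

Lemma block_emb_inj i j i' j' : block_emb i j = block_emb i' j' -> i = i' /\ j = j'.
Proof. by move=> /(congr1 val)[/val_inj-> /val_inj->]. Qed.

End positions.

Section corner_matrices.
Context {R : realType} (m N : nat) (N5 : (5 <= N)%N) (beta : R).
Hypothesis beta01 : 0 <= beta <= 1.

Local Notation n := m.+2.
Local Notation I := {i : 'I_n | i \in middle}.
Local Notation J := {p : 'I_n * 'I_n | free_position p}.
Let omax : 'I_n := ord_max.

Let middle_omax : (omax \in middle) = false.
Proof. by rewrite inE eqxx andbF. Qed.

Definition corner_entry x (i j : 'I_n) : R :=
  if insub (i, j) is Some p then free_coord N5 (p : J) x
  else if (i == omax) && (j == omax) then bad_coord N5 J x
  else if (i == 0) && (j == 0) then beta else 0.

Definition corner_mx x : 'M[R]_n :=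
  \matrix_(i, j) ((if i == j then n.+1%:R else 0) + corner_entry x i j).

Lemma corner_entry01 x i j : 0 <= corner_entry x i j <= 1.
Proof.
rewrite /corner_entry; case: insubP => [p _ _|_].
  by have := free_coord_bounds N5 p x 0; rewrite /= expr0 invr1 mul0r add0r.
case: ifP => _.
  by have := bad_coord_bounds N5 J x 0; rewrite /= expr0 invr1 mul0r add0r.
by case: ifP => // _; rewrite lexx ler01.
Qed.

Lemma corner_mx_unit x : corner_mx x \in unitmx.
Proof.
apply: diag_dominant_unitmx => i.
have e01 j : `|corner_entry x i j| <= 1.
  by have /andP[h0 h1] := corner_entry01 x i j; rewrite ger0_norm.
apply: (@le_lt_trans _ _ (\sum_(j < n | j != i) 1)).
  by apply: ler_sum => j ji; rewrite mxE eq_sym (negPf ji) add0r.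
rewrite sumr_const mxE eqxx; have /andP[h0 _] := corner_entry01 x i i.
rewrite (ger0_norm (addr_ge0 (ler0n R n.+1) h0)).
apply: (@lt_le_trans _ _ n.+1%:R); last by rewrite lerDl.
by rewrite ltr_nat ltnS; apply: leq_trans (max_card _) _; rewrite card_ord.
Qed.

Lemma corner_mx_bad x : corner_mx x omax omax = n.+1%:R + bad_coord N5 J x.
Proof.
rewrite mxE eqxx /corner_entry insubN ?eqxx//.
by rewrite /free_position /= middle_omax xpair_eqE eqxx.
Qed.

Lemma corner_mx_free x (p : J) :
  corner_mx x (val p).1 (val p).2 =
    (if (val p).1 == (val p).2 then n.+1%:R else 0) + free_coord N5 p x.
Proof. by rewrite mxE /corner_entry -surjective_pairing valK. Qed.

Lemma corner_mx_beta x : corner_mx x 0 0 = n.+1%:R + beta.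
Proof. by rewrite mxE eqxx /corner_entry insubN. Qed.

Lemma corner_mx_last x i : i != omax -> corner_mx x i omax = 0.
Proof.
move=> im; rewrite mxE (negPf im) /corner_entry insubN; last first.
  by rewrite /free_position /= middle_omax xpair_eqE (negPf im).
by rewrite (negPf im) andbF add0r.
Qed.

Lemma corner_mx_first x i : i != 0 -> i != omax -> corner_mx x i 0 = 0.
Proof.
move=> i0 im; rewrite mxE (negPf i0) /corner_entry insubN; last first.
  by rewrite /free_position /= xpair_eqE (negPf im).
by rewrite (negPf im) (negPf i0) add0r.
Qed.

Lemma corner_mx_dist x x' i j : `|corner_mx x i j - corner_mx x' i j| <=
  `|corner_mx x - corner_mx x'|.
Proof.
have /mx_norm_leP-/(_ (normr_ge0 _) i j) := lexx `|corner_mx x - corner_mx x'|.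
by rewrite !mxE.
Qed.

Lemma corner_mx_dist_bad x x' : `|bad_coord N5 J x - bad_coord N5 J x'| <=
  `|corner_mx x - corner_mx x'|.
Proof.
have := corner_mx_dist x x' omax omax; rewrite !corner_mx_bad.
by rewrite opprD addrACA subrr add0r.
Qed.

Lemma corner_mx_dist_free (p : J) x x' :
  `|free_coord N5 p x - free_coord N5 p x'| <= `|corner_mx x - corner_mx x'|.
Proof.
have := corner_mx_dist x x' (val p).1 (val p).2; rewrite !corner_mx_free.
by rewrite opprD addrACA subrr add0r.
Qed.

(** A middle row vanishes in the first and last columns, and its integer diagonal shift is absorbed
    into the translation vector. *)
Lemma corner_mx_row x (b d : 'I_n -> int) (i : I) :
  \sum_j corner_mx x (val i) j * (b j)%:~R + (d (val i))%:~R =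
  \sum_(j : I) free_coord N5 (block_emb i j) x * (b (val j))%:~R +
    (n.+1%:Z * b (val i) + d (val i))%:~R.
Proof.
have /andP[i0 im] := valP i.
rewrite rmorphD rmorphM/= addrA; congr (_ + _).
rewrite (bigID (mem middle))/= [X in _ + X]big1 ?addr0 => [|j]; last first.
  rewrite inE negb_and !negbK => /orP[|] /eqP->.
    by rewrite corner_mx_first// mul0r.
  by rewrite corner_mx_last// mul0r.
rewrite big_sub/=.
rewrite (eq_bigr (fun j : I => (if val i == val j then n.+1%:R * (b (val j))%:~R else 0) +
  free_coord N5 (block_emb i j) x * (b (val j))%:~R)); last first.
  move=> j _; have := corner_mx_free x (block_emb i j) => /= ->.
  by rewrite mulrDl; case: ifP => //; rewrite mul0r.
rewrite big_split/= addrC; congr (_ + _); rewrite -big_mkcond/=.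
by rewrite (big_pred1 i)// => j; rewrite eq_sym.
Qed.

End corner_matrices.

(** * Membership of the corner matrices in FS *)

Section corner_matrices_FS.
Context {R : realType} (m N : nat) (N5 : (5 <= N)%N) (beta : R).
Hypothesis wa_beta : well_approx beta.

Local Notation n := m.+2.
Local Notation I := {i : 'I_n | i \in @middle m}.
Local Notation J := {p : 'I_n * 'I_n | @free_position m p}.
Local Notation S := (radix_base N J).
Local Notation mx := (@corner_mx R m N N5 beta).
Local Notation TR := (measurableTypeR R).
Let omax : 'I_n := ord_max.
Let beta' : R := n.+1%:R + beta.

Let NR : 5 <= (N%:R : R). Proof. by rewrite ler_nat. Qed.

Let bad_const01 : 0 < @bad_const R N <= 2^-1.
Proof.
have N2 : 25 <= (N%:R : R) ^+ 2 by rewrite expr2; have := NR; nra.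
have N8 : 0 < 8 * (N%:R : R) ^+ 2 by lra.
by rewrite /bad_const invr_gt0 N8 lef_pV2 ?posrE//; lra.
Qed.

Let mx_badly_approx x : badly_approx (bad_const N) (mx x omax omax).
Proof.
rewrite corner_mx_bad; apply: badly_approx_addn.
by apply: skip_radix_badly_approx; exact: bad_digits_lt.
Qed.

(** Some truncated row exceeds [W], which is worth at least [1 / (30 tau)]; the condition on [N ^ K]
    keeps the truncation error below half of this. *)
Lemma corner_mx_middle_row x (tau K : nat) (b d : 'I_n -> int) : (0 < tau)%N ->
  (60 * (#|{: I}|.+1 * tau ^ 2) <= N ^ K)%N ->
  ~ small_somewhere N5 (@block_emb m) K tau (N ^ K %/ (30 * tau)) x ->
  (exists j : I, b (val j) != 0) -> (forall j, `|b j| <= tau%:Z) ->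
  exists i : I, (60 * tau%:R)^-1 <=
    `|\sum_j mx x (val i) j * (b j)%:~R + (d (val i))%:~R|.
Proof.
move=> tau0 KL nsmall bN bt; set L := (N ^ K)%N in KL nsmall.
set W := (L %/ (30 * tau))%N in nsmall.
have L0 : (0 < L)%N by rewrite expn_gt0; move: N5; clear; lia.
have : ~ small_on N5 (@block_emb m) K W (fun j => b (val j)) x.
  by move=> sm; apply: nsmall; exists (fun j => b (val j)); split => // j.
move=> /existsNP[i /forallNP nc]; exists i; rewrite corner_mx_row.
set c := (n.+1%:Z * _ + _).
have Wc := nc c; move/negP in Wc; rewrite -ltNge in Wc.
have := @truncated_form_ge R _ (fun j => free_coord N5 (block_emb i j) x)
  (block_entry N5 (@block_emb m) K x i) (fun j => b (val j)) c L W tau L0 _ _ Wc.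
move=> H; apply: le_trans (H _ (fun j => bt (val j))); last first.
  by move=> j; rewrite natrX; exact: free_coord_bounds.
have tR : 0 < (tau%:R : R) by rewrite ltr0n.
have LR : 0 < (L%:R : R) by rewrite ltr0n.
have WL : (L%:R : R) <= 30 * tau%:R * W.+1%:R.
  by rewrite -!natrM ler_nat ltnW// mulnC ltn_ceil// muln_gt0.
have KR : 60 * ((#|{: I}|%:R + 1) * tau%:R ^+ 2) <= (L%:R : R).
  by rewrite natr1 -natrX -!natrM ler_nat.
rewrite ler_pdivlMr// mulrC ler_pdivrMr ?mulr_gt0//.
rewrite natrM; have t2 : 0 < (tau%:R : R) ^+ 2 by rewrite exprn_gt0.
by rewrite mulrBl; lra.
Qed.

(** Since [Theta] is an upper limit, its positivity only needs unboundedly many [k] at which [x] is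
    not exceptional. The approximations are those of [beta'], the shifted corner entry. *)
Lemma corner_mx_FS (q p : nat -> int) (K : nat -> nat) x :
  let y k := `|(q k)%:~R * beta' + (p k)%:~R| in
  let tau k := Num.truncn ((2 * y k)^-1) in
  (forall k, [/\ q k != 0, coprimez (q k) (p k), 0 < y k,
     `|(q k)%:~R| * y k <= 2^-1 & k.+1%:R <= (2 * y k)^-1]) ->
  (forall k, (60 * (#|{: I}|.+1 * tau k ^ 2) <= N ^ K k)%N) ->
  (forall k, exists2 k', (k <= k')%N &
     ~ small_somewhere N5 (@block_emb m) (K k') (tau k')
        (N ^ K k' %/ (30 * tau k')) x) ->
  FS R n (mx x).
Proof.
move=> y tau Hq HK Hx.
have O0 i : i != omax -> mx x i omax = 0 by exact: corner_mx_last.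
have O1 i : i != 0 -> i != omax -> mx x i 0 = 0 by exact: corner_mx_first.
have ba := mx_badly_approx x.
have wa : well_approx (mx x 0 0).
  by rewrite corner_mx_beta; exact: well_approx_addn.
have /andP[c0 c1] := bad_const01.
split.
  apply: (@le_lt_trans _ _ (1 - bad_const N ^+ 2 / 16)%:E).
    exact: last_column_Theta_le bad_const01 O0 ba.
  apply: (@lt_le_trans _ _ 1%:E).
    by rewrite lte_fin ltrBlDr ltrDl divr_gt0// exprn_gt0.
  apply: le_trans (@Theta_scalar_ge1 R m _ wa_beta) _.
  by apply: ereal_sup_ubound; exists beta%:M.
move=> [|].
  by rewrite /Bad/= ltNge (corner_Theta_low_le0 O0 O1 wa).
(* The first bound comes from the middle rows, as [tau * (60 tau)^-1], the second from the last
   row. *)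
pose v : R := Num.min 60^-1 (bad_const N).
have v0 : 0 < v by rewrite lt_min c0 andbT; lra.
rewrite /Sing/= => T0.
suff : (v%:E <= Theta (mx x))%E by rewrite T0 lee_fin leNgt v0.
have vc : v <= bad_const N by rewrite ge_min lexx orbT.
have v60 : v <= 60^-1 by rewrite ge_min lexx.
apply: (corner_Theta_ge O0 O1 ba vc).
  by rewrite (ltW v0)/= (le_trans v60)// lef_pV2 ?posrE//; lra.
move=> M; have [k Mk nsmall] := Hx (Num.truncn M).
have [q0 qp y0 qy tk] := Hq k.
exists (q k), (p k); rewrite corner_mx_beta -/beta' -/(y k) /=; split => //; split.
  apply: lt_le_trans tk; apply: lt_le_trans (truncnS_gt M) _.
  by rewrite ler_nat ltnS.
move=> b d [j [j0 jm bj]] bt.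
have t0 : 0 <= (2 * y k)^-1 by apply: le_trans tk.
have /andP[tau1 tau2] := truncn_itv t0; rewrite -/(tau k) in tau1 tau2.
have tau0 : (0 < tau k)%N.
  rewrite /tau truncn_gt0; apply: le_trans tk.
  by rewrite ler1n.
have jmid : j \in @middle m by rewrite inE j0.
have [||i hi] := @corner_mx_middle_row x (tau k) (K k) b d tau0 (HK k) nsmall.
- by exists (exist _ j jmid).
- move=> l; have := bt l; rewrite -intr_norm => bl.
  by rewrite -abszE lez_nat /tau truncn_ge_nat// natr_absz.
exists (val i); apply: (@le_trans _ _ ((tau k)%:R * (60 * (tau k)%:R)^-1)).
  by rewrite invfM mulrCA mulfV ?mulr1// pnatr_eq0 -lt0n.
by apply: ler_pM.
Qed.

End corner_matrices_FS.

(** * The dimension bound *)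

Section dimension_bound.
Context {R : realType}.

(** For [N] large, [N^(D + 1 - s) >= 2] compensates [N - 2 >= N / 2]. *)
Lemma exists_radix (D : nat) (s : R) : s < D.+1%:R ->
  exists2 N : nat, (5 <= N)%N & powR N%:R s <= ((N - 2) * N ^ D)%:R.
Proof.
move=> sD; pose k := D.+1%:R - s; have k0 : 0 < k by rewrite subr_gt0.
pose N := maxn 5 (Num.truncn (powR 2 k^-1)).+1.
have N5 : (5 <= N)%N by rewrite leq_maxl.
have N2 : powR 2 k^-1 <= (N%:R : R).
  apply: ltW; apply: lt_le_trans (truncnS_gt _) _.
  by rewrite ler_nat leq_maxr.
exists N => //.
have N0 : 0 < (N%:R : R) by rewrite ltr0n; apply: leq_trans N5.
have Nk : 2 <= powR N%:R k.
  apply: (@le_trans _ _ (powR (powR 2 k^-1) k)).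
    by rewrite -powRrM mulVf ?gt_eqF// powRr1.
  by apply: ge0_ler_powR; rewrite ?nnegrE ?powR_ge0// ltW.
have E : powR N%:R s * powR N%:R k = N%:R ^+ D.+1 :> R.
  rewrite -powRD; last by apply/implyP => _; rewrite gt_eqF.
  by rewrite /k addrC subrK powR_mulrn// ltW.
rewrite -(ler_pM2r (lt_le_trans (ltr0n R 2) Nk)) E exprS natrM natrX.
have N2' : (N%:R : R) / 2 <= (N - 2)%:R.
  have N5R : 5 <= (N%:R : R) by rewrite ler_nat.
  by rewrite natrB ?(leq_trans _ N5)//; lra.
have ND : 0 <= (N%:R : R) ^+ D by rewrite exprn_ge0// ltW.
apply: (@le_trans _ _ ((N - 2)%:R * N%:R ^+ D * 2)).
  by rewrite mulrAC ler_wpM2r//; lra.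
by rewrite ler_wpM2l// mulr_ge0.
Qed.

Local Notation J m := {p : 'I_m.+2 * 'I_m.+2 | @free_position m p}.

(** Stated for any [A] containing the invertible matrices of [FS], so that it yields both halves of
    the theorem. An exponent [s] below the bound leaves room for a base [N] with [N^s <= S], and the
    mass distribution principle then excludes a null [s]-measure. *)
Lemma FS_unitmx_dimension_ge (m : nat) (A : set 'M[R]_m.+2) :
  FS R m.+2 `&` [set Om : 'M[R]_m.+2 | Om \in unitmx] `<=` A ->
  (((m.+1 ^ 2).+1%:R : R)%:E <= hausdorff_dim A)%E.
Proof.
move=> FSA; apply: le_ereal_inf_tmp => _ [s [s0 H0] <-].
rewrite lee_fin leNgt; apply/negP => sD.
have [N N5 Ns] := exists_radix sD.
have [beta wa beta01] := @exists_well_approx R.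
pose b' : R := m.+3%:R + beta.
have wa' : well_approx b' by exact: well_approx_addn.
have /choice[qp Hqp] : forall k : nat, exists qp : int * int,
    let y := `|qp.1%:~R * b' + qp.2%:~R| in
    [/\ qp.1 != 0, coprimez qp.1 qp.2, 0 < y,
       `|qp.1%:~R| * y <= 2^-1 & k.+1%:R <= (2 * y)^-1].
  move=> k; have e0 : 0 < (2 * k.+1%:R)^-1 :> R by rewrite invr_gt0 mulr_gt0.
  have k1 : 1 <= (k.+1%:R : R) by rewrite ler1n.
  have [q [p [q0 qp y0 qy]]] := wa' _ e0; exists (q, p) => /=.
  split => //; first by apply: le_trans qy _; rewrite lef_pV2 ?posrE ?mulr_gt0//; lra.
  have yle : `|q%:~R * b' + p%:~R| <= (2 * k.+1%:R)^-1.
    by apply: le_trans qy; rewrite ler_peMl ?intr_norm_ge1 ?(ltW y0).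
  rewrite -div1r ler_pdivlMr ?mulr_gt0//.
  by move: yle; rewrite -div1r ler_pdivlMr ?mulr_gt0//; lra.
pose tau k := Num.truncn ((2 * `|(qp k).1%:~R * b' + (qp k).2%:~R|)^-1).
(* The level is taken equal to the number that [N ^ K k] must dominate, which suffices because
   [K < N ^ K]. *)
pose K k := (60 * (#|{: {i : 'I_m.+2 | i \in @middle m}}|.+1 * tau k ^ 2))%N.
have tau0 k : (0 < tau k)%N.
  rewrite /tau truncn_gt0; have [_ _ _ _ h] := Hqp k; apply: le_trans h.
  by rewrite ler1n.
have KL k : (K k <= N ^ K k)%N.
  by apply/ltnW/ltn_expl; apply: leq_trans N5.
have cJ : #|{: J m}| = (m.+1 ^ 2)%N by by rewrite card_free_position.
pose small k x := small_somewhere N5 (@block_emb m) (K k) (tau k)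
  (N ^ K k %/ (30 * tau k)) (x : R).
pose P k : {set 'I_(radix_base N (J m) ^ K k)} :=
  [set a : 'I_(radix_base N (J m) ^ K k) | `[< exists x,
  (unit_itv x /\ small k x) /\ address N (J m) (K k) x = a >]]%SET.
have S0 k : (0 < radix_base N (J m) ^ K k)%N.
  by rewrite expn_gt0 ltnW// radix_base_gt1.
(* Each [E k] has measure at least 1/2, hence so has their upper limit, whose points are
   non-exceptional for infinitely many [k]. *)
pose E k : set (measurableTypeR R) := `[0, 1[ `\` cylinder (P k).
have mE k : measurable (E k).
  by apply: measurableD; [exact: measurable_itv|exact: measurable_cylinder].
have E_ge k : ((2^-1)%:E <= @lebesgue_measure R (E k))%E.
  apply: cylinder_setC_ge => //; apply: card_small_somewhere => //.
    exact: block_emb_inj.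
  by apply: leq_trans (KL k); rewrite /K leq_mul2l leq_pmull ?orbT.
have E01 k : E k `<=` `[0, 1[ by move=> x [].
have EG x : lim_sup_set E x -> unit_itv x /\
    forall k, exists2 k', (k <= k')%N & ~ small k' x.
  move=> Gx; have xu : unit_itv x.
    by have [j _ /E01] := Gx 0%N I; rewrite /= in_itv.
  split=> // k; have [j /= kj [_ ncyl]] := Gx k I; exists j => // sm.
  apply: ncyl; have /andP[x0 _] := xu.
  apply: (@cylinderP _ _ _ x (Ordinal (@address_lt R N N5 (J m) (K j) x xu))) => //.
    by rewrite natrX.
  by rewrite inE; apply/asboolP; exists x.
apply: (@hausdorff_measure_neq0 R _ A (@corner_mx R m N N5 beta) (lim_sup_set E)
  ((cover_const (J m) * radix_base N (J m))%:R) s 2^-1) H0 => //.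
- by apply: bigcapT_measurable => k; apply: bigcup_measurable => j _.
- exact: limsup_lebesgue_ge.
- move=> x /EG[xu Hx]; apply: FSA; split; last exact: corner_mx_unit.
  apply: (@corner_mx_FS R m N N5 beta wa (fun k => (qp k).1) (fun k => (qp k).2) K) => //.
- by rewrite ltr0n muln_gt0 muln_gt0 expn_gt0/= ltnW// radix_base_gt1.
move=> U U1; have [|||W [mW HW Wle]] := @cover_diam R N N5 (J m) _
    (@corner_mx R m N N5 beta) s _ s0 _ _ U U1.
- by rewrite /radix_base cJ.
- by move=> x x' _ _; exact: corner_mx_dist_bad.
- by move=> j x x' _ _; exact: corner_mx_dist_free.
exists W; split => // x /EG[xu _]; exact: HW.
Qed.

End dimension_bound.

Theorem theorem3p3 (R : realType) (n : nat) (n_ge2 : (2 <= n)%N) :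
  ((((n - 1) ^ 2 + 1)%N%:R : R)%:E <= hausdorff_dim (FS R n))%E /\
  ((((n - 1) ^ 2 + 1)%N%:R : R)%:E <=
     hausdorff_dim (FS R n `&` [set Om : 'M[R]_n | Om \in unitmx]))%E.
Proof.
case: n n_ge2 => [|[|m]]// _; rewrite subn1 addn1.
by split; apply: FS_unitmx_dimension_ge => // Om [].
Qed.
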